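(* Let $\mu\in\mathcal P$, let $\rho:=C_{k,\mathrm{ovl}}\cdot\kappa$, let $\mathfrak u=(u_H,u^{\mathrm f}_{T_1},\dots,u^{\mathrm f}_{T_{|\mathcal T_H|}})\in\mathfrak V$ be an arbitrary two-scale function, and let $\mathfrak u_\mu=\big(u_{H,k,\mu},\mathcal Q^{T_1}_{k,\mu}(u_{H,k,\mu}),\dots,\mathcal Q^{T_{|\mathcal T_H|}}_{k,\mu}(u_{H,k,\mu})\big)\in\mathfrak V$ be the two-scale solution. Then the following energy error bounds hold: $$|||\mathfrak u_\mu-\mathfrak u|||_{a,\mu}\ \le\ \eta_{a,\mu}(\mathfrak u)\ \le\ \sqrt5\,\gamma_k^{-1}\beta^{1/2}\,|||\mathfrak u_\mu-\mathfrak u|||_{a,\mu}.$$ Further, $$\Big(\|u_{H,k,\mu}-u_H\|_1^2+\rho\sum_{T\in\mathcal T_H}\|\mathcal Q^T_{k,\mu}(u_H)-u_T^{\mathrm f}\|_1^2\Big)^{1/2}\le\eta_{1,\mu}(\mathfrak u),$$ and $$\eta_{1,\mu}(\mathfrak u)\le\sqrt{15}\,C_{\mathcal I_H}(C_{k,\mathrm{ovl}}+1)^{1/2}\kappa^{1/2}\gamma_k^{-1}\beta^{1/2}\Big(\|u_{H,k,\mu}-u_H\|_1^2+\rho\sum_{T\in\mathcal T_H}\|\mathcal Q^T_{k,\mu}(u_H)-u_T^{\mathrm f}\|_1^2\Big)^{1/2}.$$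
   Context: **Problem.** $\mathcal P\subset\mathbb R^p$ is a parameter set, $\Omega\subset\mathbb R^d$ a bounded Lipschitz domain, $V:=H^1_0(\Omega)$, $f\in L^2(\Omega)$, and for each $\mu\in\mathcal P$, $A_\mu\in L^\infty(\Omega,\mathbb R^{d\times d})$ is symmetric with $\alpha|\xi|^2\le\xi^TA_\mu(x)\xi\le\beta|\xi|^2$ for all $\mu\in\mathcal P$, $x\in\Omega$, $\xi\in\mathbb R^d$, where $0<\alpha\le\beta<\infty$ are fixed; $\kappa:=\beta/\alpha$. Set $a_\mu(u,v):=\int_\Omega (A_\mu\nabla u)\cdot\nabla v\,dx$, $F(v):=\int_\Omega fv\,dx$, and for $T\subseteq\Omega$ let $a_\mu^T(u,v):=\int_T(A_\mu\nabla u)\cdot\nabla v\,dx$. Norms on $V$: $\|v\|_1^2:=\int_\Omega|\nabla v|^2dx$, $\|v\|_{a,\mu}^2:=\int_\Omega|A_\mu^{1/2}\nabla v|^2dx$. **Discretization.** $V_h\subset V$ is a (finite-dimensional) conforming finite-element space over a shape-regular mesh $\mathcal T_h$ of $\Omega$; $\mathcal T_H=\{T_1,\dots,T_{|\mathcal T_H|}\}$ is a coarse mesh aligned with $\mathcal T_h$; $V_H:=V_h\cap\mathcal P_1(\mathcal T_H)\neq\{0\}$, where $\mathcal P_1(\mathcal T_H)$ denotes the continuous, $\mathcal T_H$-piecewise affine functions. For $\omega\subseteq\Omega$, $U_0(\omega):=\omega$ and $U_{k+1}(\omega):=\operatorname{Int}\big(\overline{\bigcup\{T\in\mathcal T_H: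 \overline{U_k(\omega)}\cap\overline T\ne\emptyset\}}\big)$. Fix an integer $k\ge0$ and set $C_{k,\mathrm{ovl}}:=\max_{x\in\Omega}\#\{T\in\mathcal T_H: x\in U_k(T)\}$. $\mathcal I_H:V_h\to V_H$ is linear with $\mathcal I_H(v_H)=v_H$ for $v_H\in V_H$ and $\|\mathcal I_H(v_h)\|_1\le C_{\mathcal I_H}\|v_h\|_1$ for $v_h\in V_h$. **Correctors.** $V_h^{\mathrm f}:=\ker\mathcal I_H$ and $V^{\mathrm f}_{h,k,T}:=V_h^{\mathrm f}\cap H^1_0(U_k(T))$ (functions extended by zero). For $v_h\in V_h$, $\mathcal Q^T_{k,\mu}(v_h)\in V^{\mathrm f}_{h,k,T}$ is the solution of $a_\mu(\mathcal Q^T_{k,\mu}(v_h),v^{\mathrm f})=a_\mu^T(v_h,v^{\mathrm f})$ for all $v^{\mathrm f}\in V^{\mathrm f}_{h,k,T}$. Set $\mathcal Q_{k,\mu}:=\sum_{T\in\mathcal T_H}\mathcal Q^T_{k,\mu}$. **PG--LOD solution.** $$\gamma_k:=\inf_{0\ne w_H\in V_H}\sup_{0\ne v_H\in V_H}\frac{a_\mu(w_H-\mathcal Q_{k,\mu}(w_H),v_H)}{\|w_H-\mathcal Q_{k,\mu}(w_H)\|_{a,\mu}\,\|v_H\|_1}.$$ Standing assumptions: $\gamma_k>0$ and $\gamma_k\le\alpha^{1/2}$. $u_{H,k,\mu}\in V_H$ denotes the unique element with $a_\mu(u_{H,k,\mu}-\mathcal Q_{k,\mu}(u_{H,k,\mu}),v_H)=F(v_H)$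 for all $v_H\in V_H$. **Two-scale objects.** $\mathfrak V:=V_H\oplus V^{\mathrm f}_{h,k,T_1}\oplus\cdots\oplus V^{\mathrm f}_{h,k,T_{|\mathcal T_H|}}$. For $\mathfrak u=(u_H,u^{\mathrm f}_{T_1},\dots,u^{\mathrm f}_{T_{|\mathcal T_H|}})$, $\mathfrak v=(v_H,v^{\mathrm f}_{T_1},\dots,v^{\mathrm f}_{T_{|\mathcal T_H|}})$ in $\mathfrak V$ and stabilization parameter $\rho$, $$\mathfrak B_\mu(\mathfrak u,\mathfrak v):=a_\mu\Big(u_H-\sum_{T\in\mathcal T_H}u^{\mathrm f}_T,\,v_H\Big)+\rho^{1/2}\sum_{T\in\mathcal T_H}\big(a_\mu(u_T^{\mathrm f},v_T^{\mathrm f})-a_\mu^T(u_H,v_T^{\mathrm f})\big),\qquad\mathfrak F(\mathfrak v):=F(v_H),$$ $$|||\mathfrak u|||_1^2:=\|u_H\|_1^2+\sum_{T\in\mathcal T_H}\|u_T^{\mathrm f}\|_1^2,\qquad |||\mathfrak u|||_{a,\mu}^2:=\Big\|u_H-\sum_{T\in\mathcal T_H}u_T^{\mathrm f}\Big\|_{a,\mu}^2+\rho\sum_{T\in\mathcal T_H}\|\mathcal Q^T_{k,\mu}(u_H)-u_T^{\mathrm f}\|_{a,\mu}^2.$$ The two-scale solution $\mathfrak u_\mu\in\mathfrak V$ is the unique solution of $\mathfrak B_\mu(\mathfrak u_\mu,\mathfrak v)=\mathfrak F(\mathfrak v)$ for all $\mathfrak v\in\mathfrak V$, and it has the components given in the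 claim. **Error indicators.** For $\mathfrak u\in\mathfrak V$, $$\eta_{a,\mu}(\mathfrak u):=\sqrt5\,\gamma_k^{-1}\sup_{0\neq\mathfrak v\in\mathfrak V}\frac{\mathfrak F(\mathfrak v)-\mathfrak B_\mu(\mathfrak u,\mathfrak v)}{|||\mathfrak v|||_1},\qquad \eta_{1,\mu}(\mathfrak u):=\sqrt5\,C_{\mathcal I_H}\alpha^{-1/2}\gamma_k^{-1}\sup_{0\neq\mathfrak v\in\mathfrak V}\frac{\mathfrak F(\mathfrak v)-\mathfrak B_\mu(\mathfrak u,\mathfrak v)}{|||\mathfrak v|||_1}.$$ *)

(* Defs.v *)
From HB Require Import structures.
From mathcomp Require Import all_boot all_order all_algebra.
From mathcomp Require Import all_classical all_reals all_analysis.
Import numFieldNormedType.Exports.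
Set Implicit Arguments. Unset Strict Implicit. Unset Printing Implicit Defensive.
Import Order.TTheory GRing.Theory Num.Theory.
Local Open Scope classical_set_scope.
Local Open Scope ring_scope.

(* The sigma-algebra generated by the coordinate maps, i.e., the Borel sets
   (the analogue of the instance of the library on [n.-tuple T]). *)
Section measurable_rV.
Context {R : realType}.
Variable n : nat.
Let coord (i : 'I_n) (x : 'rV[R]_n) : R := x ord0 i.

Let rV_set0 : g_sigma_preimage coord set0.
Proof. exact: sigma_algebra0. Qed.

Let rV_setC A : g_sigma_preimage coord A -> g_sigma_preimage coord (~` A).
Proof. exact: sigma_algebraC. Qed.

Let rV_bigcup (F : _^nat) : (forall i, g_sigma_preimage coord (F i)) ->
  g_sigma_preimage coord (\bigcup_i (F i)).
Proof. exact: sigma_algebra_bigcup. Qed.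

HB.instance Definition _ :=
  @isMeasurable.Build (measure_tuple_display default_measure_display)
    'rV[R]_n (g_sigma_preimage coord) rV_set0 rV_setC rV_bigcup.

End measurable_rV.

Section coord.
Context {R : realType}.
Lemma measurable_rV_coord n (i : 'I_n) :
  measurable_fun [set: 'rV[R]_n] (fun x : 'rV[R]_n => x ord0 i).
Proof.
move=> _ Y mY; rewrite setTI; apply: sub_sigma_algebra => /=.
rewrite -bigcup_seq/=; exists i => /=; first by rewrite mem_index_enum.
by exists Y => //; rewrite setTI.
Qed.

Lemma measurable_fun_rV d (T : measurableType d) n (f : T -> 'rV[R]_n) :
  (forall i, measurable_fun [set: T] (fun t => f t ord0 i)) ->
  measurable_fun [set: T] f.
Proof.
move=> mf _.
have sub : g_sigma_preimage (fun (i : 'I_n) (x : 'rV[R]_n) => x ord0 i) `<=`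
    [set B | measurable (f @^-1` B)].
  apply: smallest_sub; first split.
  - by rewrite /= preimage_set0.
  - by move=> A mA; rewrite /= setTD -preimage_setC; exact: measurableC.
  - by move=> F mF; rewrite /= preimage_bigcup; exact: bigcupT_measurable.
  move=> B; rewrite -bigcup_seq => -[i _ [C mC <-]] /=.
  have := mf i measurableT C mC.
  by rewrite !setTI.
by move=> B /sub; rewrite setTI.
Qed.
End coord.

Section leb.
Context {R : realType}.

Definition rV_cons n (p : R * 'rV[R]_n) : 'rV[R]_n.+1 :=
  \row_i oapp (p.2 ord0) p.1 (unlift ord0 i).

Lemma rV_cons0 n (p : R * 'rV[R]_n) : rV_cons p ord0 ord0 = p.1.
Proof. by rewrite mxE unlift_none. Qed.

Lemma rV_consS n (p : R * 'rV[R]_n) j :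
  rV_cons p ord0 (lift ord0 j) = p.2 ord0 j.
Proof. by rewrite mxE liftK. Qed.

Lemma measurable_rV_cons n : measurable_fun setT (@rV_cons n).
Proof.
apply: measurable_fun_rV => i; case: (unliftP ord0 i) => [j ->|->].
  under eq_fun do rewrite rV_consS.
  exact: (measurableT_comp (measurable_rV_coord j) measurable_snd).
under eq_fun do rewrite rV_cons0.
exact: measurable_fst.
Qed.

Section step.
Variables (n : nat) (m : {sigma_finite_measure set 'rV[R]_n -> \bar R}).
Definition leb_step : set 'rV[R]_n.+1 -> \bar R :=
  pushforward (@lebesgue_measure R \x m)%E (@rV_cons n).

Let leb_stepE : {measure set 'rV[R]_n.+1 -> \bar R} :=
  measure_function_pushforward__canonical__measure_function_Measure
    (@lebesgue_measure R \x m)%E (@measurable_rV_cons n).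

Let leb_step0 : leb_step set0 = 0%E.
Proof. exact: (measure0 leb_stepE). Qed.

Let leb_step_ge0 A : (0 <= leb_step A)%E.
Proof. exact: (measure_ge0 leb_stepE). Qed.

Let leb_step_sigma_additive : semi_sigma_additive leb_step.
Proof. exact: (@measure_semi_sigma_additive _ _ _ leb_stepE). Qed.

HB.instance Definition _ := isMeasure.Build _ _ _ leb_step
  leb_step0 leb_step_ge0 leb_step_sigma_additive.

Let leb_step_sigma_finite : sigma_finite setT leb_step.
Proof.
have /sigma_finiteP[F [TF ndF Foo]] := sigma_finiteT (@lebesgue_measure R).
have /sigma_finiteP[G [TG ndG Goo]] := sigma_finiteT m.
pose g (x : 'rV[R]_n.+1) : (measurableTypeR R * 'rV[R]_n)%type := (x ord0 ord0, \row_j x ord0 (lift ord0 j)).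
have mg : measurable_fun setT g.
  apply: measurable_fun_pair; first exact: measurable_rV_coord.
  apply: measurable_fun_rV => i; under eq_fun do rewrite mxE.
  exact: measurable_rV_coord.
have gK : cancel (@rV_cons n) g.
  move=> [x v]; rewrite /g rV_cons0; congr (_, _).
  by apply/rowP => j; rewrite mxE rV_consS.
exists (fun k => g @^-1` (F k `*` G k)).
  rewrite -preimage_bigcup; apply/seteqP; split=> // x _ /=.
  have [i _ Fi] : (\bigcup_k F k) (g x).1 by rewrite -TF.
  have [j _ Gj] : (\bigcup_k G k) (g x).2 by rewrite -TG.
  exists (maxn i j) => //; split.
    by move: Fi; exact/subsetPset/ndF/leq_maxl.
  by move: Gj; exact/subsetPset/ndG/leq_maxr.
move=> k; have [mF Fk] := Foo k; have [mG Gk] := Goo k; split.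
  rewrite -[X in measurable X]setTI; apply: mg => //; exact: measurableX.
rewrite /leb_step /pushforward (_ : _ @^-1` _ = F k `*` G k); last first.
  by rewrite -comp_preimage; apply/seteqP; split => p; rewrite /preimage /mkset [(g \o _) p]gK.
by rewrite product_measure1E// lte_mul_pinfty// ge0_fin_numE.
Qed.

HB.instance Definition _ := Measure_isSigmaFinite.Build _ _ _ leb_step leb_step_sigma_finite.
End step.

(* [lebn n] is the n-fold product of [lebesgue_measure], transported along
   [rV_cons]. *)
Fixpoint lebn n : {sigma_finite_measure set 'rV[R]_n -> \bar R} :=
  match n with
  | 0 => dirac (0 : 'rV[R]_0)
  | n'.+1 => leb_step (lebn n')
  end.

Lemma lebn_box n (a b : 'rV[R]_n) : (forall i, a ord0 i <= b ord0 i) ->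
  lebn n [set x | forall i, a ord0 i < x ord0 i < b ord0 i]
    = (\prod_(i < n) (b ord0 i - a ord0 i))%:E.
Proof.
elim: n a b => [|n IH] a b ab.
  rewrite big_ord0 /= diracE mem_set//; by case.
rewrite big_ord_recl EFinM.
have := IH (\row_j a ord0 (lift ord0 j)) (\row_j b ord0 (lift ord0 j)).
under eq_bigr do rewrite !mxE.
move=> <-; last by move=> i; rewrite !mxE.
rewrite [LHS]/= /leb_step /pushforward.
rewrite (_ : _ @^-1` _ = `]a ord0 ord0, b ord0 ord0[ `*` 
  [set x : 'rV[R]_n | forall i, (\row_j a ord0 (lift ord0 j)) ord0 i < x ord0 i < (\row_j b ord0 (lift ord0 j)) ord0 i]); last first.
  apply/seteqP; split => [[x v] /= H|[x v] /= [Hx Hv] i].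
    split; first by rewrite in_itv /=; have := H ord0; rewrite rV_cons0.
    by move=> i; have := H (lift ord0 i); rewrite rV_consS !mxE.
  case: (unliftP ord0 i) => [j ->|->].
    by have := Hv j; rewrite rV_consS !mxE.
  by rewrite rV_cons0; move: Hx; rewrite in_itv.
rewrite product_measure1E//.
  congr (_ * _)%E; rewrite [LHS](lebesgue_measure_itv `]a ord0 ord0, b ord0 ord0[).
  rewrite /= lte_fin lt_neqAle ab andbT EFinB.
  by case: eqVneq => //= ->; rewrite -EFinB subrr.
set S := [set x | _].
rewrite (_ : S = \bigcap_(i in [set: 'I_n]) 
   ((fun x : 'rV[R]_n => x ord0 i) @^-1` `](\row_j a ord0 (lift ord0 j)) ord0 i, (\row_j b ord0 (lift ord0 j)) ord0 i[)).
  apply: fin_bigcap_measurable => // i _; rewrite -[X in measurable X]setTI; apply: measurable_rV_coord => //.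
by apply/seteqP; split => [x H i _|x H i]; have := H i; rewrite /= in_itv/=; last apply.
Qed.
End leb.

Section problem.
Context {R : realType} {d : nat}.
Notation point := 'rV[R]_d.
Notation fct := ('rV[R]_d -> R).
Notation lam := (@lebn R d).
Implicit Types (x y z e xi : point) (U D Omega : set point) (u v w f g : fct).

(* Points and vectors are rows. *)

Definition dot x y : R := (x *m y^T) ord0 ord0.
Definition enorm x : R := Num.sqrt (dot x x).

(* The vector [M xi], written as a row. *)
Definition mxapp (M : 'M[R]_d) xi : point := xi *m M^T.

(* The symmetric positive semidefinite square root of [M]. *)
Definition sqrtmx (M : 'M[R]_d) : 'M[R]_d :=
  xget 0 [set S | [/\ S^T = S, (forall xi, 0 <= dot xi (mxapp S xi))
                    & S *m S = M]].

(* Near each boundary point, [Omega] is the strict epigraph, in the direction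
   of a unit vector [e], of a Lipschitz function of the coordinates orthogonal
   to [e] (i.e., a Lipschitz function invariant under translations along [e]). *)
Definition lipschitz_boundary Omega : Prop :=
  forall z, closure Omega z -> ~ Omega z ->
  exists (r L : R) e g,
    [/\ 0 < r, enorm e = 1,
        (forall x y, `|g x - g y| <= L * enorm (x - y)),
        (forall x (t : R), g (x + t *: e) = g x)
      & forall x, enorm (x - z) < r -> (Omega x <-> g x < dot x e)].

Definition bounded_lipschitz_domain Omega : Prop :=
  [/\ open Omega, connected Omega, Omega !=set0, bounded_set Omega
    & lipschitz_boundary Omega].

Definition partial (i : 'I_d) u : fct :=
  fun x => 'D_(delta_mx ord0 i : point) u x.

Fixpoint Ck (k : nat) u : Prop :=
  continuous u /\
  if k is k'.+1 then
    forall i, (forall x, derivable u x (delta_mx ord0 i)) /\ Ck k' (partial i u)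
  else True.

(* C_c^oo(U), extended by zero. *)
Definition test_fun U u : Prop :=
  [/\ forall k, Ck k u, compact (closure [set x | u x != 0])
    & closure [set x | u x != 0] `<=` U].

Definition L2 U u : Prop :=
  measurable_fun U u /\ (\int[lam]_(x in U) (u x ^+ 2)%:E < +oo)%E.

Definition weak_partial U (i : 'I_d) u g : Prop :=
  forall phi : fct, test_fun U phi ->
    \int[lam]_(x in U) (u x * partial i phi x) =
    - \int[lam]_(x in U) (g x * phi x).

(* Weak derivatives are only determined almost everywhere; [wpartial U i u] is
   one representative in L2(U). *)
Definition wpartial U (i : 'I_d) u : fct :=
  xget (0 : fct) [set g | L2 U g /\ weak_partial U i u g].

Definition grad U u x : point := \row_i wpartial U i u x.

Definition H1 U u : Prop :=
  L2 U u /\ forall i, exists g, L2 U g /\ weak_partial U i u g.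

Definition H1_sqnorm U u : \bar R :=
  (\int[lam]_(x in U) (u x ^+ 2 + dot (grad U u x) (grad U u x))%:E)%E.

(* The closure of C_c^oo(U) in H^1(U). *)
Definition H10 U u : Prop :=
  H1 U u /\ exists phi : nat -> fct,
    (forall n, test_fun U (phi n)) /\
    (fun n => H1_sqnorm U (phi n - u)) @ \oo --> 0%E.

(* H^1_0(U), with functions extended by zero to the whole space. *)
Definition H10ext U : set fct :=
  [set u | H10 U u /\ forall x, ~ U x -> u x = 0].

(* [A mu] is in L^oo(Omega), symmetric and uniformly elliptic. *)
Definition elliptic_coeff p (P : set 'rV[R]_p) Omega (alpha beta : R)
    (A : 'rV[R]_p -> point -> 'M[R]_d) : Prop :=
  forall mu, P mu ->
  [/\ (forall i j, measurable_fun Omega (fun x => A mu x i j)),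
      (exists M : R, forall i j, {ae lam, forall x, Omega x -> `|A mu x i j| <= M}),
      (forall x, Omega x -> (A mu x)^T = A mu x)
    & forall x, Omega x -> forall xi,
        alpha * enorm xi ^+ 2 <= dot xi (mxapp (A mu x) xi) <= beta * enorm xi ^+ 2].

(* The integral of (B grad u) . grad v over D, for B the coefficient field. *)
Definition aform Omega (B : point -> 'M[R]_d) D u v : R :=
  \int[lam]_(x in D) dot (mxapp (B x) (grad Omega u x)) (grad Omega v x).

Definition Fform Omega f v : R := \int[lam]_(x in Omega) (f x * v x).

Definition norm1 Omega v : R :=
  Num.sqrt (\int[lam]_(x in Omega) (enorm (grad Omega v x) ^+ 2)).

Definition norma Omega (B : point -> 'M[R]_d) v : R :=
  Num.sqrt (\int[lam]_(x in Omega)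
    (enorm (mxapp (sqrtmx (B x)) (grad Omega v x)) ^+ 2)).

(* Elements are open; they cover [Omega] up to the (null) mesh skeleton.  No
   particular element geometry (simplices, quadrilaterals, ...) is imposed. *)
Definition mesh Omega n (T : 'I_n -> set point) : Prop :=
  [/\ (forall i, open (T i) /\ T i !=set0),
      (forall i, T i `<=` Omega),
      (forall i j, i != j -> T i `&` T j = set0),
      closure Omega = \bigcup_i closure (T i)
    & lam (Omega `\` \bigcup_i T i) = 0%E].

(* The ratio of diameter and inradius of the elements is at most [theta]. *)
Definition shape_regular (theta : R) n (T : 'I_n -> set point) : Prop :=
  forall i, exists z (r : R),
    [/\ 0 < r, (forall x, enorm (x - z) < r -> T i x)
      & forall x y, T i x -> T i y -> enorm (x - y) <= theta * r].

(* The coarse elements [TH] are unions of elements of the fine mesh [Th]. *)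
Definition aligned N n (TH : 'I_N -> set point) (Th : 'I_n -> set point) : Prop :=
  forall i, exists J : set 'I_n, closure (TH i) = \bigcup_(j in J) closure (Th j).

Definition subspace_fct (W : set fct) : Prop :=
  W 0 /\ forall (c : R) u v, W u -> W v -> W (c *: u + v).

Definition finite_dim (W : set fct) : Prop :=
  exists m (b : 'I_m -> fct), forall v, W v ->
    exists c : 'I_m -> R, v = \sum_(i < m) c i *: b i.

(* [S j] is the finite-dimensional space of shape functions on the element
   [Th j] (e.g., polynomials up to some degree).  Elements of the finite element
   space are represented by their continuous representatives, extended by
   zero, so that equality in H^1_0(Omega) is equality of functions. *)
Definition conforming_fe_space Omega n (Th : 'I_n -> set point)
    (S : 'I_n -> set fct) (Vh : set fct) : Prop :=
  [/\ subspace_fct Vh, finite_dim Vh, Vh `<=` H10ext Omega,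
      (forall j, subspace_fct (S j) /\ finite_dim (S j))
    & forall v, Vh v -> continuous v /\
        forall j, exists2 w, S j w & forall x, Th j x -> v x = w x].

Definition P1 Omega N (TH : 'I_N -> set point) : set fct :=
  [set v | {within closure Omega, continuous v} /\
    forall i, exists (c : point) (b : R), forall x, TH i x -> v x = dot c x + b].

Fixpoint coarse_patch N (TH : 'I_N -> set point) (k : nat) (omega : set point)
    : set point :=
  if k is k'.+1 then
    interior (closure (\bigcup_(i in [set i |
      closure (coarse_patch TH k' omega) `&` closure (TH i) !=set0]) TH i))
  else omega.

(* The maximum over x in Omega of the number of patches containing x, taken over
   the attained values m. *)
Definition overlap Omega N (TH : 'I_N -> set point) (k : nat) : nat :=
  \max_(m < N.+1 | `[< exists2 x, Omega x &
                       #|[pred i : 'I_N | `[< coarse_patch TH k (TH i) x >]]| = m >]) m.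

Definition coarse_space Omega N (TH : 'I_N -> set point) (Vh : set fct) : set fct :=
  Vh `&` P1 Omega TH.

Definition fine_space (Vh : set fct) (IH : fct -> fct) : set fct :=
  [set v | Vh v /\ IH v = 0].

Definition fine_space_loc N (TH : 'I_N -> set point) (k : nat) (Vh : set fct)
    (IH : fct -> fct) (i : 'I_N) : set fct :=
  fine_space Vh IH `&` H10ext (coarse_patch TH k (TH i)).

Definition interpolation Omega (Vh VH : set fct) (CI : R) (IH : fct -> fct) : Prop :=
  [/\ (forall v, Vh v -> VH (IH v)),
      (forall (c : R) u v, Vh u -> Vh v -> IH (c *: u + v) = c *: IH u + IH v),
      (forall v, VH v -> IH v = v)
    & forall v, Vh v -> norm1 Omega (IH v) <= CI * norm1 Omega v].

(* [Q i] is the corrector of the element [TH i]; [Vf i] is its local fine space. *)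
Definition correctors Omega (B : point -> 'M[R]_d) N (TH : 'I_N -> set point)
    (Vh : set fct) (Vf : 'I_N -> set fct) (Q : 'I_N -> fct -> fct) : Prop :=
  forall i v, Vh v -> Vf i (Q i v) /\
    forall w, Vf i w -> aform Omega B Omega (Q i v) w = aform Omega B (TH i) v w.

Definition corrector_sum N (Q : 'I_N -> fct -> fct) v : fct := \sum_(i < N) Q i v.

Definition infsup Omega (B : point -> 'M[R]_d) (VH : set fct) (Qk : fct -> fct) : R :=
  inf [set sup [set aform Omega B Omega (w - Qk w) v /
                    (norma Omega B (w - Qk w) * norm1 Omega v)
               | v in VH `\ 0] | w in VH `\ 0].

Definition pg_lod_solution Omega (B : point -> 'M[R]_d) f (VH : set fct)
    (Qk : fct -> fct) u : Prop :=
  VH u /\ forall v, VH v -> aform Omega B Omega (u - Qk u) v = Fform Omega f v.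

Definition two_scale_space N (VH : set fct) (Vf : 'I_N -> set fct)
    : set (fct * ('I_N -> fct)) :=
  [set u | VH u.1 /\ forall i, Vf i (u.2 i)].

Section two_scale.
Variables (Omega : set point) (B : point -> 'M[R]_d) (N : nat)
  (TH : 'I_N -> set point) (f : fct) (rho : R) (Q : 'I_N -> fct -> fct).
Implicit Types uu vv : fct * ('I_N -> fct).

Definition Bform uu vv : R :=
  aform Omega B Omega (uu.1 - \sum_(i < N) uu.2 i) vv.1 +
  Num.sqrt rho * \sum_(i < N)
    (aform Omega B Omega (uu.2 i) (vv.2 i) - aform Omega B (TH i) uu.1 (vv.2 i)).

Definition ts_norm1 uu : R :=
  Num.sqrt (norm1 Omega uu.1 ^+ 2 + \sum_(i < N) norm1 Omega (uu.2 i) ^+ 2).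

Definition ts_norma uu : R :=
  Num.sqrt (norma Omega B (uu.1 - \sum_(i < N) uu.2 i) ^+ 2 +
            rho * \sum_(i < N) norma Omega B (Q i uu.1 - uu.2 i) ^+ 2).

(* The dual norm of the residual of [uu] over the two-scale space [VV]. *)
Definition residual (VV : set (fct * ('I_N -> fct))) uu : R :=
  sup [set (Fform Omega f vv.1 - Bform uu vv) / ts_norm1 vv | vv in VV `\ 0].

Definition eta_a VV (gamma : R) uu : R :=
  Num.sqrt 5 * gamma^-1 * residual VV uu.

Definition eta_1 VV (gamma CI alpha : R) uu : R :=
  Num.sqrt 5 * CI * (Num.sqrt alpha)^-1 * gamma^-1 * residual VV uu.

End two_scale.

End problem.

(* Main.v *)
Require Import Defs.
From HB Require Import structures.
From mathcomp Require Import all_boot all_order all_algebra.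
From mathcomp Require Import complex spectral sesquilinear.
From mathcomp Require Import all_classical all_reals all_analysis.
From mathcomp Require Import measurable_realfun ring lra.
Import numFieldNormedType.Exports.
Set Implicit Arguments. Unset Strict Implicit. Unset Printing Implicit Defensive.
Import Order.TTheory GRing.Theory Num.Theory.
Local Open Scope classical_set_scope.
Local Open Scope ring_scope.

(** The residual of a two-scale function u is the two-scale form evaluated at the
    error e = u_mu - u, because the load F can be replaced by the form at the
    solution. Its dual norm is therefore equivalent to the energy norm of e as soon as
    the form is bounded and inf-sup stable, and all four bounds follow from these two
    properties and a comparison of norms.

    Boundedness (tsform_continuous) is the Cauchy-Schwarz inequality, once the
    corrector equations have rewritten the fine part of the form in terms of the
    local errors Q_i e_H - e_i.

    For the inf-sup estimate (tsform_infsup), let w = e_H - sum_i Q_i e_H and let r be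
    the sum of e_i - Q_i e_H, so that the total error is w - r. Finite overlap of the
    patches and the choice of rho bound the energy of r by the stabilization term. A
    near maximizer v of the Petrov-Galerkin quotient of w serves as coarse test
    function. Decomposing w and r along v and orthogonally to v, the component of
    w - r along v is tested directly, and the orthogonal component of w is small since
    v is nearly optimal (infsup_scalar). This yields the factor sqrt 3 instead of
    sqrt 5 for every constant below gamma, hence the claim without any limit.
    The H^1 bounds come from the projection property of the interpolation
    (tse2_le) and from the energy bound for correctors (tsa2_le).

    All of this takes place in an abstract space with semi-inner products. What the
    concrete function spaces contribute is the following. The weak gradient is linear almost everywhere, which rests on the fundamental
    lemma of the calculus of variations (ae_eq0_of_test_fun), proved with smooth bumps
    supported in boxes. The spaces of functions vanishing off a patch are
    linear, which in addition requires integration by parts for test functions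
    (integral_partial0). A function vanishing off a patch has a gradient vanishing
    there almost everywhere, which gives the finite overlap estimate (aform_overlap).
    The energy norm is the norm of the bilinear form, since positive
    semidefinite matrices have symmetric square roots (psd_sqrt_exists). *)

(** * Boxes and Borel sets of row vectors *)

Section boxes.
Context {R : realType} {n : nat}.
Implicit Types (a b x : 'rV[R]_n) (U D : set 'rV[R]_n).

Definition box a b : set 'rV[R]_n := [set x | forall i, a 0 i < x 0 i < b 0 i].
Definition cbox a b : set 'rV[R]_n := [set x | forall i, a 0 i <= x 0 i <= b 0 i].
Definition boxes : set (set 'rV[R]_n) := [set B | exists a b, B = box a b].

Lemma measurable_box a b : measurable (box a b).
Proof.
have -> : box a b = \bigcap_(i in [set: 'I_n])
    ((fun x : 'rV[R]_n => x ord0 i) @^-1` `]a 0 i, b 0 i[).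
  by apply/seteqP; split => x H i => [_|]; have := H i; rewrite /= in_itv//=; apply.
apply: fin_bigcap_measurable => // i _; rewrite -[X in measurable X]setTI.
exact: measurable_rV_coord.
Qed.

Definition rowmax a b : 'rV[R]_n := \row_i Num.max (a 0 i) (b 0 i).
Definition rowmin a b : 'rV[R]_n := \row_i Num.min (a 0 i) (b 0 i).

Lemma boxI a b c e : box a b `&` box c e = box (rowmax a c) (rowmin b e).
Proof.
apply/seteqP; split => [x [H1 H2] i|x H]; rewrite ?mxE.
  have /andP[h1 h2] := H1 i; have /andP[h3 h4] := H2 i.
  by rewrite gt_max lt_min h1 h2 h3 h4.
by split=> i; have := H i; rewrite !mxE gt_max lt_min =>
    /andP[/andP[h1 h2] /andP[h3 h4]]; rewrite ?h1 ?h2 ?h3 ?h4.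
Qed.

Lemma box_setI : setI_closed boxes.
Proof.
by move=> _ _ [a [b ->]] [c [e ->]]; rewrite boxI; do 2 eexists.
Qed.

Definition cube k : set 'rV[R]_n := box (const_mx (- k%:R)) (const_mx k%:R).

Lemma cube_cover : \bigcup_k cube k = setT.
Proof.
apply/seteqP; split => // x _.
exists (\max_(i < n) (Num.truncn `|x ord0 i|)).+1 => // i; rewrite !mxE -ltr_norml.
apply: lt_le_trans (truncnS_gt _) _.
by rewrite ler_nat ltnS (leq_bigmax i).
Qed.

(** The coordinate preimage of an interval is the increasing union of the boxes
    that have this interval as one side and sides growing to the whole line
    otherwise; this turns equality of integrals over boxes into equality over all
    Borel sets. *)
Lemma measurable_rVE : @measurable _ 'rV[R]_n = <<s boxes >>.
Proof.
apply/seteqP; split; last first.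
  apply: smallest_sub; first exact: sigma_algebra_measurable.
  by move=> _ [a [b ->]]; exact: measurable_box.
apply: smallest_sub; first exact: smallest_sigma_algebra.
move=> B; rewrite -bigcup_seq/= => -[i _ [C mC <-]].
have : measurable_fun [set: g_sigma_algebraType boxes] (fun x : 'rV[R]_n => x 0 i).
  apply: (measurability _ (measurable_realfun.RGenOpens.measurableE R)).
  move=> _ [_ [a [b ->]] <-]; rewrite setTI.
  have -> : (fun x : 'rV[R]_n => x 0 i) @^-1` `]a, b[ =
     \bigcup_k box (\row_j if j == i then a else - k%:R) (\row_j if j == i then b else k%:R).
    apply/seteqP; split => x.
      rewrite /= in_itv /= => xab.
      have : setT x by []; rewrite -cube_cover => -[k _ xk].
      exists k => // j; rewrite !mxE; case: eqP => [->//|_].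
      by have := xk j; rewrite !mxE.
    by move=> [k _ /(_ i)]; rewrite !mxE eqxx /= in_itv.
  apply: (@bigcup_measurable _ (g_sigma_algebraType boxes)) => k _.
  by apply: sub_sigma_algebra; do 2 eexists.
by move=> /(_ measurableT _ mC).
Qed.

Lemma open_box_sub U x : open U -> U x ->
  exists2 ab : 'rV[rat]_n * 'rV[rat]_n,
    box (map_mx ratr ab.1) (map_mx ratr ab.2) x &
    cbox (map_mx ratr ab.1) (map_mx ratr ab.2) `<=` U.
Proof.
move=> oU Ux.
have /nbhs_ballP[e /= e0 HU] : nbhs x U by exact: open_nbhs_nbhs.
have Ha i : exists q : rat, x 0 i - e < ratr q < x 0 i.
  have /rat_in_itvoo[q] : x 0 i - e < x 0 i by rewrite ltrBlDr ltrDl.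
  by rewrite in_itv; exists q.
have Hb i : exists q : rat, x 0 i < ratr q < x 0 i + e.
  have /rat_in_itvoo[q] : x 0 i < x 0 i + e by rewrite ltrDl.
  by rewrite in_itv; exists q.
have /choice[qa Hqa] := Ha; have /choice[qb Hqb] := Hb.
exists (\row_i qa i, \row_i qb i) => /=.
  by move=> i; rewrite !mxE; have /andP[_ ->] := Hqa i; have /andP[-> _] := Hqb i.
move=> y Hy; apply: HU; split => // i j; rewrite (ord1 i).
have := Hy j; rewrite !mxE => /andP[H1 H2].
have /andP[H3 _] := Hqa j; have /andP[_ H4] := Hqb j.
by rewrite /ball /= ltr_distlC; apply/andP; split; lra.
Qed.

(** Rational corners make the union countable; asking for closed boxes inside U
    leaves room for test functions supported in them. *)
Lemma open_bigcup_box U : open U ->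
  U = \bigcup_(ab in [set ab : 'rV[rat]_n * 'rV[rat]_n | cbox (map_mx ratr ab.1) (map_mx ratr ab.2) `<=` U]) box (map_mx ratr ab.1) (map_mx ratr ab.2).
Proof.
move=> oU; apply/seteqP; split => [x Ux|x [ab /= abU xab]].
  by have [ab ? ?] := open_box_sub oU Ux; exists ab.
by apply: abU => i; have /andP[/ltW -> /ltW ->] := xab i.
Qed.

Lemma open_measurable_rV U : open U -> measurable U.
Proof.
move=> oU; rewrite (open_bigcup_box oU).
rewrite bigcup_mkcond; apply: countable_bigcupT_measurable; first exact: countableP.
by move=> ab; case: ifP => _ //; exact: measurable_box.
Qed.

Lemma continuous_measurable_rV D (u : 'rV[R]_n -> R) : measurable D ->
  continuous u -> measurable_fun D u.
Proof.
move=> mD /continuousP cu.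
apply: (@measurable_funS _ _ _ _ setT) => //.
apply: (measurability _ (measurable_realfun.RGenOpens.measurableE R)).
move=> _ [_ [a [b ->]] <-]; rewrite setTI.
by apply: open_measurable_rV; apply: cu; exact: interval_open.
Qed.

Lemma box_cbox a b : box a b `<=` cbox a b.
Proof. by move=> x H i; have /andP[/ltW -> /ltW ->] := H i. Qed.

Lemma cboxI_subl a b c e : cbox (rowmax a c) (rowmin b e) `<=` cbox a b.
Proof.
move=> x H i; have := H i; rewrite !mxE ge_max le_min.
by move=> /andP[/andP[-> _] /andP[-> _]].
Qed.

Lemma cbox_compact a b : compact (cbox a b).
Proof.
have := @rV_compact R n (fun i => `[a 0 i, b 0 i]%classic).
move=> /(_ (fun i => @segment_compact _ _ _)).
by congr compact; apply/seteqP; split => x H i; have := H i; rewrite /= in_itv.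
Qed.

Lemma cbox_closed a b : closed (cbox a b).
Proof. by apply: compact_closed; [exact: norm_hausdorff|exact: cbox_compact]. Qed.

End boxes.

(** * Smooth bumps supported in boxes *)

(** Transfers the one-variable chain rule, and Fubini's slices, to directional
    derivatives. *)
Lemma is_derive_line {R : realType} {V : normedModType R} (f : V -> R) x v df :
  is_derive (0 : R) 1 (fun s : R => f (s *: v + x)) df <-> is_derive x v f df.
Proof.
have E : (fun h : R => h^-1 *: (((fun s : R => f (s *: v + x)) \o shift (0:R)) (h *: (1:R)) -
      f ((0:R) *: v + x))) =
    (fun h : R => h^-1 *: ((f \o shift x) (h *: v) - f x)).
  apply/funext => h /=.
  by rewrite /= addr0 scale0r add0r [h *: (1 : R)]mulr1.
by split => -[d1 d2]; split; move: d1 d2; rewrite /derivable /derive /= E.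
Qed.

Section smooth_step.
Context {R : realType}.
Implicit Types (q : {poly R}) (t : R).

(** The family t |-> q(1/t) exp(-1/t) on t > 0, extended by zero, is indexed by
    polynomials q because it is then stable under differentiation. *)
Definition expinv q t : R := if 0 < t then q.[t^-1] * expR (- t^-1) else 0.

Lemma horner_le_expR q : exists2 K : R, 0 <= K & forall y : R, 0 <= y -> `|q.[y]| <= K * expR y.
Proof.
have Hn i : exists2 K : R, 0 <= K & forall y : R, 0 <= y -> y ^+ i <= K * expR y.
  case: i => [|i].
    by exists 1 => // y y0; rewrite mul1r expr0 -expR0 ler_expR.
  exists (i.+1`!)%:R => // y y0.
  have f0 : 0 < (i.+1`!)%:R :> R by rewrite ltr0n fact_gt0.
  rewrite mulrC -ler_pdivrMr//.
  by apply: le_trans (expR_ge1Dxn i y0); rewrite lerDr.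
elim/poly_ind: q => [|q c [K K0 HK]].
  by exists 0 => // y y0; rewrite horner0 normr0 mul0r.
suff [K' K'0 HK'] : exists2 K : R, 0 <= K & forall y : R, 0 <= y -> `|(q * 'X).[y]| <= K * expR y.
  exists (K' + `|c|); first by rewrite addr_ge0.
  move=> y y0; rewrite hornerD hornerC (le_trans (ler_normD _ _))// mulrDl lerD ?HK'//.
  by rewrite ler_peMr// -expR0 ler_expR.
move: q {K K0 HK} => q.
exists (\sum_(i < size (q * 'X)) `|(q * 'X)`_i| * xget 0 [set K : R | 0 <= K /\ forall y : R, 0 <= y -> y ^+ i <= K * expR y]).
  apply: sumr_ge0 => i _; rewrite mulr_ge0//; case: xgetP => // y _ [] //.
move=> y y0; rewrite horner_coef mulr_suml; apply: le_trans (ler_norm_sum _ _ _) _.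
apply: ler_sum => i _; rewrite normrM -mulrA ler_wpM2l//.
rewrite ger0_norm ?exprn_ge0//; case: xgetP => [K _ [_ ->]//|H].
by have [K K0 HK] := Hn i; case: (H K).
Qed.

(** Quadratic decay at zero gives a vanishing derivative there, the only point
    where differentiability is not a matter of computation. *)
Lemma expinv_le_sqr q : exists2 K : R, 0 <= K & forall t, `|expinv q t| <= K * t ^+ 2.
Proof.
have [K K0 HK] := horner_le_expR (q * 'X^2).
exists K => // t; rewrite /expinv; case: ifPn => t0; last first.
  by rewrite normr0 mulr_ge0// sqr_ge0.
have := HK t^-1; rewrite invr_ge0 ltW// => /(_ isT).
rewrite hornerM hornerXn !normrM [`|expR _|]gtr0_norm ?expR_gt0//.
rewrite [`|t^-1|]gtr0_norm ?invr_gt0// -invfM -expr2.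
rewrite expRN ler_pdivrMr ?exprn_gt0// ler_pdivrMr ?expR_gt0//.
by rewrite mulrAC.
Qed.

Definition expinv_next q := (q - q^`()) * 'X^2.

Lemma is_derive_expinv q t : is_derive t 1 (expinv q) (expinv (expinv_next q) t).
Proof.
have [t0|t0|->] := ltgtP t 0.
- apply: (@near_eq_is_derive _ _ _ (cst 0)).
    near=> s; rewrite /expinv ltNge ltW//; near: s.
    exact: lt_nbhsl.
  rewrite /expinv ltNge ltW//=; exact: is_derive_cst.
- apply: (@near_eq_is_derive _ _ _ (fun s : R => q.[s^-1] * expR (- s^-1))).
    near=> s; rewrite /expinv ifT//; near: s.
    exact: lt_nbhsr.
  have dV : is_derive t 1 (fun s : R => s^-1) (- t ^- 2 *: (1 : R)).
    by apply: is_deriveV; rewrite gt_eqF.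
  have dN : is_derive t 1 (fun s : R => - s^-1) (- (- t ^- 2 *: (1 : R))).
    exact: is_deriveN.
  have d1 := is_derive1_comp (is_derive_poly q t^-1) dV.
  have d2 := @is_derive1_comp _ expR (fun s : R => - s^-1) t _ _ (is_derive_expR _) dN.
  apply: (is_derive_eq (is_deriveM d1 d2)); rewrite /expinv t0 /expinv_next /= hornerM hornerXn !hornerE /=.
  rewrite /GRing.scale /= expr2 invfM; ring.
- apply/is_derive1_caratheodory; exists (fun z => expinv q z / z); split.
  + move=> z; rewrite /expinv ltxx !subr0; case: ifP => z0; last by rewrite !mul0r.
    by rewrite divfK// gt_eqF.
  + rewrite /prop_for /continuous_at invr0 mulr0.
    have [K K0 HK] := expinv_le_sqr q.
    apply/cvgrPdist_le => e e0.
    have Kp : 0 < e / (K + 1) by rewrite divr_gt0// ltr_wpDl.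
    near=> z; have zK : `|z| <= e / (K + 1).
      near: z; apply/nbhs_ballP; exists (e / (K + 1)) => // y.
      by rewrite /ball /= sub0r normrN => /ltW.
    rewrite sub0r normrN normrM normfV.
    have [->|z0] := eqVneq z 0; first by rewrite normr0 invr0 mulr0 ltW.
    rewrite ler_pdivrMr ?normr_gt0//; apply: le_trans (HK z) _.
    rewrite -real_normK ?num_real// expr2 mulrA ler_wpM2r//.
    apply: (@le_trans _ _ ((K + 1) * (e / (K + 1)))); last first.
      by rewrite mulrCA divff ?mulr1// gt_eqF// ltr_wpDl.
    by rewrite ler_pM// lerDl.
  + by rewrite /expinv ltxx mul0r.
Unshelve. all: by end_near. Qed.

Lemma expinv1 t : expinv 1 t = if 0 < t then expR (- t^-1) else 0.
Proof. by rewrite /expinv hornerE mul1r. Qed.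

Lemma expinv_continuous q : continuous (expinv q).
Proof.
move=> t; apply: differentiable_continuous; apply/derivable1_diffP.
by have [] := is_derive_expinv q t.
Qed.

End smooth_step.

Section Ck_theory.
Context {R : realType} {d : nat}.
Implicit Types (u v : 'rV[R]_d -> R) (k : nat).

Lemma Ck_continuous k u : Ck k u -> continuous u.
Proof. by case: k => [|k] []. Qed.

Lemma Ck_weaken k u : Ck k.+1 u -> Ck k u.
Proof.
elim: k u => [u [cu _] //|k IHk u [cu Hu]]; split=> // i.
by have [du Hi] := Hu i; split => //; apply: IHk.
Qed.

Lemma Ck_cst k (c : R) : Ck k (cst c : 'rV[R]_d -> R).
Proof.
elim: k c => [c|k IHk c]; split => //; try exact: cst_continuous.
move=> i; split; first by move=> x; exact: derivable_cst.
rewrite (_ : partial i _ = cst 0); first exact: IHk.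
by apply/funext => y; rewrite /partial derive_cst.
Qed.

Lemma CkD k u v : Ck k u -> Ck k v -> Ck k (u + v).
Proof.
have cD u' v' : continuous u' -> continuous v' -> continuous (u' + v' : 'rV[R]_d -> R).
  by move=> cu cv x; exact: (cvgD (cu x) (cv x)).
elim: k u v => [|k IHk] u v [cu Hu] [cv Hv]; split => //; try exact: cD.
move=> i; have [du Hui] := Hu i; have [dv Hvi] := Hv i; split.
  by move=> x; apply: derivableD.
rewrite (_ : partial i _ = partial i u + partial i v); first exact: IHk.
by apply/funext => x; rewrite /partial deriveD.
Qed.

Lemma CkM k u v : Ck k u -> Ck k v -> Ck k (u * v).
Proof.
have cM u' v' : continuous u' -> continuous v' -> continuous (u' * v' : 'rV[R]_d -> R).
  by move=> cu cv x; exact: (cvgM (cu x) (cv x)).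
elim: k u v => [|k IHk] u v Cu Cv; move: (Cu) (Cv) => [cu Hu] [cv Hv];
  split => //; try exact: cM.
move=> i; have [du Hui] := Hu i; have [dv Hvi] := Hv i; split.
  by move=> x; apply: derivableM.
rewrite (_ : partial i _ = u * partial i v + v * partial i u).
  by apply: CkD; apply: IHk => //; apply: Ck_weaken.
by apply/funext => x; rewrite /partial deriveM.
Qed.

Lemma Ck_prod k (I : finType) (F : I -> 'rV[R]_d -> R) :
  (forall i, Ck k (F i)) -> Ck k (\prod_i F i).
Proof.
move=> H; apply: big_ind => //; first exact: (Ck_cst k 1).
exact: CkM.
Qed.

(** Smooth functions of one coordinate; boxes being products of intervals, their
    products are all the smooth functions needed. *)
Lemma is_derive_expinv_affine q (c e : R) (i : 'I_d) x (w : 'rV[R]_d) :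
  is_derive x w (fun x : 'rV[R]_d => expinv q (c * x 0 i + e))
    (c * w 0 i * expinv (expinv_next q) (c * x 0 i + e)).
Proof.
apply/is_derive_line.
have -> : (fun s : R => expinv q (c * (s *: w + x) 0 i + e)) =
   expinv q \o (fun s => s * (c * w 0 i) + (c * x 0 i + e)).
  by apply/funext => s /=; rewrite !mxE; congr expinv; ring.
rewrite [X in is_derive _ _ _ X]mulrC.
apply: is_derive1_comp.
  by rewrite mul0r add0r; exact: is_derive_expinv.
have := is_deriveD (is_deriveZ (c * w 0 i) (is_derive_id (0:R) 1)) (is_derive_cst (c * x 0 i + e) (0 : R) 1).
set f := (X in is_derive _ _ X _ -> _).
have -> : f = (fun s => s * (c * w 0 i) + (c * x 0 i + e)).
  by apply/funext => s; rewrite /f /= !fctE /= /GRing.scale /= mulrC.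
move=> H; apply: (is_derive_eq H); by rewrite addr0 /GRing.scale /= mulr1.
Qed.

Lemma Ck_expinv_affine k q (c e : R) (i : 'I_d) :
  Ck k (fun x : 'rV[R]_d => expinv q (c * x 0 i + e)).
Proof.
have cont q' : continuous (fun x : 'rV[R]_d => expinv q' (c * x 0 i + e)).
  move=> x; apply: (@continuous_comp _ _ _ (fun x : 'rV[R]_d => c * x 0 i + e) (expinv q')).
    exact: (cvgD (cvgM (cvg_cst c) (@coord_continuous R 1 d 0 i x)) (cvg_cst e)).
  exact: expinv_continuous.
elim: k q => [|k IHk] q; split => // j; split.
  by move=> x; have [] := is_derive_expinv_affine q c e i x (delta_mx ord0 j).
rewrite (_ : partial j _ = cst (c * (delta_mx 0 j : 'rV[R]_d) 0 i) *
  (fun x : 'rV[R]_d => expinv (expinv_next q) (c * x 0 i + e))).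
  by apply: CkM; [exact: Ck_cst|exact: IHk].
apply/funext => x; rewrite /partial.
by have [_ ->] := is_derive_expinv_affine q c e i x (delta_mx ord0 j).
Qed.

(** The dilation factor m + 1 sharpens the step, so that the bumps converge to the
    indicator of the open box while remaining supported in the closed one. *)
Definition box_bump (a b : 'rV[R]_d) (m : nat) : 'rV[R]_d -> R :=
  \prod_i ((fun x : 'rV[R]_d => expinv 1 (m.+1%:R * x 0 i + - (m.+1%:R * a 0 i))) *
   (fun x : 'rV[R]_d => expinv 1 (- m.+1%:R * x 0 i + m.+1%:R * b 0 i))).

Lemma box_bumpE a b m x : box_bump a b m x =
  \prod_i (expinv 1 (m.+1%:R * (x 0 i - a 0 i)) * expinv 1 (m.+1%:R * (b 0 i - x 0 i))).
Proof.
rewrite /box_bump fct_prodE; apply: eq_bigr => i _ /=; rewrite fctE /=.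
by congr (expinv _ _ * expinv _ _); ring.
Qed.

Lemma box_bump_out a b m x : ~ box a b x -> box_bump a b m x = 0.
Proof.
move=> /existsNP[i Hi]; rewrite box_bumpE (bigD1 i)//=.
rewrite !expinv1 !pmulr_rgt0// !subr_gt0.
by move/negP: Hi; rewrite negb_and => /orP[/negbTE ->|/negbTE ->]; rewrite ?mul0r ?mulr0 ?mul0r.
Qed.

Lemma expinv01 (t : R) : 0 <= expinv 1 t <= 1.
Proof.
rewrite expinv1; case: ifPn => t0; last by rewrite lexx ler01.
by rewrite expR_ge0 -expR0 ler_expR oppr_le0 invr_ge0 ltW.
Qed.

Lemma box_bump01 a b m x : 0 <= box_bump a b m x <= 1.
Proof.
rewrite box_bumpE; apply/andP; split.
  by apply: prodr_ge0 => i _; rewrite mulr_ge0//; have /andP[] := expinv01 (m.+1%:R * (x 0 i - a 0 i));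
    have /andP[] := expinv01 (m.+1%:R * (b 0 i - x 0 i)).
apply: prodr_ile1 => i _.
have /andP[? ?] := expinv01 (m.+1%:R * (x 0 i - a 0 i)).
have /andP[? ?] := expinv01 (m.+1%:R * (b 0 i - x 0 i)).
by rewrite mulr_ge0//= mulr_ile1.
Qed.

Lemma box_bump_cvg a b x : (fun m => box_bump a b m x) @ \oo --> (\1_(box a b) x : R).
Proof.
rewrite indicE; have [|xb] := boolP (x \in box a b); last first.
  rewrite (_ : (fun m => _) = cst 0); first exact: cvg_cst.
  by apply/funext => m; apply: box_bump_out; rewrite notin_setE in xb.
rewrite inE => xb /=.
have H t : 0 < t -> (fun m => expinv 1 (m.+1%:R * t)) @ \oo --> (1 : R).
  move=> t0; rewrite (_ : (fun m => _) = expR \o (fun m => - t^-1 * harmonic m)).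
    rewrite -[X in _ --> X]expR0; apply: (@cvg_comp _ _ _ (fun m => - t^-1 * harmonic m) expR _ (nbhs (0 : R))).
      have := cvgM (cvg_cst (- t^-1)) (@cvg_harmonic R).
      by rewrite mulr0; apply.
    exact: continuous_expR.
  apply/funext => m /=; rewrite expinv1 pmulr_rgt0// t0 /harmonic invfM mulNr.
  by rewrite mulrC.
rewrite (_ : (fun m => _) = \prod_i (fun m => expinv 1 (m.+1%:R * (x 0 i - a 0 i)) *
    expinv 1 (m.+1%:R * (b 0 i - x 0 i)))); last first.
  by apply/funext => m; rewrite box_bumpE fct_prodE.
apply: (big_ind (fun f : nat -> R => f @ \oo --> (1 : R))).
- exact: cvg_cst.
- by move=> f g cf cg; rewrite -[X in _ --> X](mulr1 1); apply: cvgM.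
- move=> i _; rewrite -[X in _ --> X](mulr1 1).
  by have /andP[? ?] := xb i; apply: cvgM; apply: H; rewrite subr_gt0.
Qed.

Lemma test_fun_box_bump (U : set 'rV[R]_d) a b m : cbox a b `<=` U -> test_fun U (box_bump a b m).
Proof.
move=> abU.
have sub : closure [set x | box_bump a b m x != 0] `<=` cbox a b.
  have /closure_id -> := @cbox_closed R d a b.
  apply: closureS => x /= xb; apply: contrapT => H.
  move/eqP: xb; apply; apply: box_bump_out => Hb; apply: H => i.
  by have /andP[/ltW -> /ltW ->] := Hb i.
split.
- by move=> k; apply: Ck_prod => i; apply: CkM; exact: Ck_expinv_affine.
- by apply: subclosed_compact sub; [exact: closed_closure|exact: cbox_compact].
- exact: subset_trans sub abU.
Qed.

End Ck_theory.

(** * Square-integrable functions and the fundamental lemma *)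

Section L2_theory.
Context {R : realType} {d : nat}.
Notation lam := (@lebn R d).
Implicit Types (U D : set 'rV[R]_d) (u v g : 'rV[R]_d -> R).

Lemma integrableZl_EFin U (c : R) u : measurable U -> lam.-integrable U (EFin \o u) ->
  lam.-integrable U (EFin \o (fun x => c * u x)).
Proof. by move=> mU Iu; have := integrableZl mU c Iu. Qed.

Lemma L2_integrable_sqr U u : L2 U u -> lam.-integrable U (EFin \o (fun x => u x ^+ 2)).
Proof.
move=> [mu u2]; apply/integrableP; split.
  by apply/measurable_EFinP; exact: measurable_funX.
by under eq_integral do rewrite /= ger0_norm ?sqr_ge0//.
Qed.

Lemma L2_of_integrable_sqr U u : measurable_fun U u ->
  lam.-integrable U (EFin \o (fun x => u x ^+ 2)) -> L2 U u.
Proof.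
move=> mu /integrableP[_ H]; split => //.
by move: H; under eq_integral do rewrite /= ger0_norm ?sqr_ge0//.
Qed.

Lemma L2_integrable_mul U u v : measurable U -> L2 U u -> L2 U v ->
  lam.-integrable U (EFin \o (fun x => u x * v x)).
Proof.
move=> mU Lu Lv; have Iu := L2_integrable_sqr Lu; have Iv := L2_integrable_sqr Lv.
apply: (le_integrable mU _ _ (integrableD mU Iu Iv)).
  by apply/measurable_EFinP; apply: measurable_funM; [case: Lu|case: Lv].
move=> x Ux /=; rewrite lee_fin normrM [leRHS]ger0_norm ?addr_ge0 ?sqr_ge0//.
rewrite -[u x ^+ 2]real_normK ?num_real// -[v x ^+ 2]real_normK ?num_real//.
have := sqr_ge0 (`|u x| - `|v x|); have := sqr_ge0 `|u x|; have := sqr_ge0 `|v x|.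
rewrite !expr2; lra.
Qed.

Lemma L2_lin U (c : R) u v : measurable U -> L2 U u -> L2 U v -> L2 U (c *: u + v).
Proof.
move=> mU Lu Lv; have mcuv : measurable_fun U (c *: u + v).
  by apply: measurable_funD; [apply: measurable_funM => //; case: Lu|case: Lv].
apply: L2_of_integrable_sqr => //.
have Iu := L2_integrable_sqr Lu; have Iv := L2_integrable_sqr Lv.
have := integrableD mU (integrableZl mU (2 * c ^+ 2) Iu) (integrableZl mU 2 Iv).
apply: le_integrable => //; first by apply/measurable_EFinP; exact: measurable_funX.
move=> x Ux /=; rewrite lee_fin !ger0_norm ?sqr_ge0//; last first.
  by rewrite addr_ge0// mulr_ge0 ?sqr_ge0// mulr_ge0// sqr_ge0.
rewrite !fctE /= /GRing.scale /=.
have := sqr_ge0 (c * u x - v x); rewrite !expr2; lra.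
Qed.

Lemma L2S U D u : measurable U -> measurable D -> D `<=` U -> L2 U u -> L2 D u.
Proof.
move=> mU mD DU Lu; apply: L2_of_integrable_sqr.
  by case: Lu => mu _; apply: measurable_funS mu.
exact: integrableS (L2_integrable_sqr Lu).
Qed.

Lemma lebn_cube_lty k : (lam (@cube R d k) < +oo)%E.
Proof.
have := @lebn_box R d (const_mx (- k%:R)) (const_mx k%:R).
rewrite -/(box _ _) -/(cube k) => ->; rewrite ?ltry// => i.
by rewrite !mxE (@le_trans _ _ 0)// oppr_le0.
Qed.

Lemma L2_bounded U u (M : R) k : measurable U -> measurable_fun U u ->
  (forall x, U x -> `|u x| <= M) -> (forall x, U x -> ~ cube k x -> u x = 0) -> L2 U u.
Proof.
move=> mU mu uM u0; apply: L2_of_integrable_sqr => //.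
have mk : measurable (@cube R d k) by exact: measurable_box.
have I1 : lam.-integrable U (EFin \o \1_(@cube R d k)).
  apply: (@integrableS _ _ _ _ setT) => //.
  apply/integrableP; split; first by apply/measurable_EFinP.
  under eq_integral do rewrite /= ger0_norm//.
  by rewrite integral_indic// setIT lebn_cube_lty.
apply: (le_integrable mU _ _ (integrableZl mU (M ^+ 2) I1)); first by apply/measurable_EFinP; exact: measurable_funX.
move=> x Ux /=; rewrite lee_fin ger0_norm ?sqr_ge0// ger0_norm; last first.
  by rewrite mulr_ge0// sqr_ge0.
rewrite indicE; have [xk|/negP xk] := boolP (x \in cube k); last first.
  rewrite u0 ?expr0n ?mulr0//; by move=> H; apply: xk; rewrite inE.
rewrite mulr1 -real_normK ?num_real// lerXn2r// ?nnegrE// ?uM//.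
exact: le_trans (uM _ Ux).
Qed.

Lemma compact_bounded_cube (K : set 'rV[R]_d) : compact K -> exists k, K `<=` cube k.
Proof.
move=> /compact_bounded[M [_ HM]].
have M1 : M < `|M| + 1 by rewrite (le_lt_trans (ler_norm _))// ltrDl.
exists (Num.truncn (`|M| + 1)).+1 => x Kx i.
rewrite !mxE -ltr_norml; apply: le_lt_trans (truncnS_gt _).
apply: le_trans (HM _ M1 _ Kx).
rewrite [leRHS]/Num.Def.normr /= mx_normrE; apply/bigmax_geP; right => /=.
by exists (ord0, i).
Qed.

Definition csupp u := compact (closure [set x | u x != 0]).

Lemma csupp_cube u : csupp u -> exists k, forall x, ~ cube k x -> u x = 0.
Proof.
move=> /compact_bounded_cube[k Hk]; exists k => x xk; apply: contrapT => /eqP ux.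
by apply: xk; apply: Hk; exact: subset_closure.
Qed.

Lemma csupp_bounded u : continuous u -> csupp u -> exists M : R, forall x, `|u x| <= M.
Proof.
move=> cu su; have : compact (u @` closure [set x | u x != 0]).
  by apply: continuous_compact => //; exact: continuous_subspaceT.
move=> /compact_bounded[M [_ HM]].
have M1 : M < `|M| + 1 by rewrite (le_lt_trans (ler_norm _))// ltrDl.
exists (`|M| + 1) => x; have [ux|ux] := eqVneq (u x) 0.
  by rewrite ux normr0 addr_ge0.
by apply: (HM _ M1); exists x => //; exact: subset_closure.
Qed.

Lemma L2_csupp U u : measurable U -> continuous u -> csupp u -> L2 U u.
Proof.
move=> mU cu su; have [k Hk] := csupp_cube su; have [M HM] := csupp_bounded cu su.
apply: (@L2_bounded U u M k) => //; last by move=> x _; exact: Hk.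
exact: continuous_measurable_rV.
Qed.

Lemma L2_indic_box U a b : measurable U -> L2 U (\1_(box a b) : 'rV[R]_d -> R).
Proof.
move=> mU; have [k Hk] := compact_bounded_cube (@cbox_compact R d a b).
apply: (@L2_bounded U _ 1 k) => //.
- by apply: (@measurable_funS _ _ _ _ setT) => //; apply: measurable_indic; exact: measurable_box.
- by move=> x _; rewrite indicE; case: (_ \in _); rewrite ?normr1 ?normr0.
- move=> x _ xk; rewrite indicE; case: (boolP (x \in box a b)) => //; rewrite inE => xb.
  by exfalso; apply: xk; apply: Hk => i; have /andP[/ltW -> /ltW ->] := xb i.
Qed.

(** Boxes form a generating pi-system, and the sets over which the integral of h
    vanishes form a Dynkin system; the integral then vanishes over every Borel set. *)
Lemma ae_eq0_of_boxes (h : 'rV[R]_d -> R) : lam.-integrable setT (EFin \o h) ->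
  (\int[lam]_x (h x)%:E = 0)%E ->
  (forall a b, (\int[lam]_(x in box a b) (h x)%:E = 0)%E) ->
  {ae lam, forall x, h x = 0}.
Proof.
move=> Ih hT hB.
have H E : measurable E -> (\int[lam]_(x in E) (h x)%:E = 0)%E.
  move=> mE; move: (mE); rewrite measurable_rVE.
  move: E {mE}.
  apply: (@dynkin_induction _ 'rV[R]_d boxes
    (fun E => \int[lam]_(x in E) (h x)%:E = 0)%E measurable_rVE box_setI).
  - exact: hT.
  - by move=> _ [a [b ->]]; exact: hB.
  - move=> S mS S0; move: hT; rewrite -(setUv S) integral_setU//.
    + by rewrite S0 add0e.
    + exact: measurableC.
    + by rewrite setUv; exact: (measurable_int lam).
    + by apply/disj_setPCl.
  - move=> F mF tF F0; rewrite (@integral_bigcup _ _ _ lam F (EFin \o h))//.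
      by apply: eseries0 => i _ _; exact: F0.
    by apply: integrableS Ih => //; exact: bigcup_measurable.
have : ae_eq lam setT (EFin \o h) (cst 0%E).
  apply: integral_ae_eq => //.
  by move=> E _ mE; rewrite H// integral0.
apply: filterS => x /(_ I) /= []//.
Qed.

(** Fundamental lemma of the calculus of variations: testing against bumps, which
    converge to indicators of boxes, reduces it to vanishing integrals over boxes.
    All uniqueness statements on weak gradients rest on it. *)
Lemma ae_eq0_of_test_fun U g : open U -> L2 U g ->
  (forall phi, test_fun U phi -> \int[lam]_(x in U) (g x * phi x) = 0) ->
  {ae lam, forall x, U x -> g x = 0}.
Proof.
move=> oU Lg Hg; have mU := open_measurable_rV oU.
(* The indicator of the box bounds the bumps and is their pointwise limit. *)
have Hbox a b : cbox a b `<=` U -> (\int[lam]_(x in U) (g x * \1_(box a b) x)%:E = 0)%E.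
  move=> abU.
  have mb m : measurable_fun U (box_bump a b m).
    apply: continuous_measurable_rV => //.
    by have [/(_ 0%N) [] ] := test_fun_box_bump m abU.
  have mg : measurable_fun U g by case: Lg.
  have mI : measurable_fun U (\1_(box a b) : _ -> R).
    by case: (@L2_indic_box U a b mU).
  have cvg := @dominated_cvg _ _ _ lam U mU (fun m x => (g x * box_bump a b m x)%:E)
    (fun x => (g x * \1_(box a b) x)%:E) (fun x => `|g x * \1_(box a b) x|%:E).
  have {}cvg := cvg _ _ _ _.
  have : (fun m => \int[lam]_(x in U) (g x * box_bump a b m x)%:E)%E @ \oo -->
    (\int[lam]_(x in U) (g x * \1_(box a b) x)%:E)%E.
    apply: cvg.
    - by move=> m; apply/measurable_EFinP; exact: measurable_funM.
    - move=> x Ux; apply: cvg_EFin; first by apply: nearW.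
      exact: (cvgM (cvg_cst _) (@box_bump_cvg R d a b x)).
    - by [].
    - apply: integrable_norm.
      exact: (L2_integrable_mul mU Lg (L2_indic_box _ _ mU)).
    - move=> m x Ux /=; rewrite lee_fin !normrM ler_wpM2l//.
      have /andP[b0 b1] := box_bump01 a b m x; rewrite ger0_norm//.
      rewrite indicE; have [xb|xb] := boolP (x \in box a b); first by rewrite normr1.
      by rewrite box_bump_out ?normr0//; rewrite notin_setE in xb.
  rewrite (_ : (fun m => _) = cst 0%E); last first.
    apply/funext => m; have tb := test_fun_box_bump m abU.
    have := Hg _ tb; rewrite /Rintegral => f0.
    rewrite -[LHS]fineK ?f0//; apply: integrable_fin_num => //.
    apply: (L2_integrable_mul mU Lg); have [/(_ 0%N) [] cb _ sb _] := tb.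
    exact: L2_csupp.
  by move/(cvg_lim (@ereal_hausdorff R)); rewrite lim_cst//; exact: ereal_hausdorff.
(* Inside a box whose closure lies in U, every box is again such a box. *)
have Hae a b : cbox a b `<=` U -> {ae lam, forall x, box a b x -> g x = 0}.
  move=> abU; have bU : box a b `<=` U.
    by move=> x xb; apply: abU => i; have /andP[/ltW -> /ltW ->] := xb i.
  have mab := @measurable_box R d a b.
  have Ig : lam.-integrable U (EFin \o (fun x => g x * \1_(box a b) x)).
    exact: (L2_integrable_mul mU Lg (L2_indic_box _ _ mU)).
  pose h := g \_ (box a b).
  have Ih : lam.-integrable setT (EFin \o h).
    rewrite /h -restrict_EFin; apply: (integrable_mkcond (EFin \o g) mab).1.
    have := integrableS mU mab bU Ig; apply: eq_integrable => // x xb /=.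
    by rewrite indicE xb mulr1.
  have hE D : measurable D -> (\int[lam]_(x in D) (h x)%:E =
      \int[lam]_(x in D `&` box a b) (g x)%:E)%E.
    by move=> mD; rewrite integral_mkcondr; under [RHS]eq_integral do rewrite restrict_EFin.
  have gI D : measurable D -> D `<=` U -> (\int[lam]_(x in D) (g x)%:E =
      \int[lam]_(x in U) (g x * \1_D x)%:E)%E.
    move=> mD DU; rewrite -[in LHS](setIidr DU) integral_mkcondr.
    apply: eq_integral => x _; rewrite patchE indicE.
    by case: ifP; rewrite ?mulr1 ?mulr0.
  have h0 : {ae lam, forall x, h x = 0}.
    apply: ae_eq0_of_boxes => //.
      by rewrite hE// setTI gI// Hbox.
    move=> c e; have mce := @measurable_box R d c e.
    rewrite hE// setIC gI; first by rewrite boxI Hbox//; apply: subset_trans abU; exact: cboxI_subl.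
      exact: measurableI.
    by move=> x [] /bU.
  apply: filterS h0 => x; rewrite /h patchE => + xb.
  by rewrite mem_set.
apply: (@negligibleS _ _ _ _ (\bigcup_k (if (unpickle k : option ('rV[rat]_d * 'rV[rat]_d)) is Some ab then
   [set x | cbox (map_mx ratr ab.1) (map_mx ratr ab.2) `<=` U /\
            ~ (box (map_mx ratr ab.1) (map_mx ratr ab.2) x -> g x = 0)]
   else set0))).
  move=> x /= /not_implyP[Ux gx]; have [ab xab abU] := open_box_sub oU Ux.
  by exists (pickle ab) => //; rewrite pickleK; split=> //; exact/not_implyP.
apply: negligible_bigcup => k; case: unpickle => [ab|]; last exact: negligible_set0.
have [abU|abU] := pselect (cbox (map_mx ratr ab.1) (map_mx ratr ab.2) `<=` U).
  by apply: negligibleS (Hae _ _ abU) => x [_].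
by apply: negligibleS (@negligible_set0 _ _ _ _) => x [].
Qed.

End L2_theory.

(** * Integrals of partial derivatives *)

Section integral_of_partial.
Context {R : realType}.

Lemma not_cube_abs n k (x : 'rV[R]_n) : ~ cube k x -> exists i, k%:R <= `|x 0 i|.
Proof.
move=> /existsNP[j]; rewrite !mxE -ltr_norml => /negP; rewrite -leNgt => Hj.
by exists j.
Qed.

Lemma abs_not_cube n k (x : 'rV[R]_n) i : k%:R <= `|x 0 i| -> ~ cube k x.
Proof. by move=> Hi /(_ i); rewrite !mxE -ltr_norml ltNge Hi. Qed.

(** Bounded support, in a form that passes to slices in fewer variables. *)
Definition bsupp n k (u : 'rV[R]_n -> R) := forall x, ~ cube k x -> u x = 0.

(** One unit of slack: a point with a coordinate of modulus at least k + 1 has a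
    whole neighbourhood off the cube of half-width k. *)
Lemma partial_bsupp n k (u : 'rV[R]_n -> R) i : bsupp k u -> bsupp k.+1 (partial i u).
Proof.
move=> u0 x /not_cube_abs[j xj].
rewrite /partial (@near_eq_derive _ _ _ _ (cst 0)); first exact: derive_cst.
apply/nbhs_ballP; exists 1 => //= y [_ /(_ 0 j)].
rewrite /ball /= => xyj; apply: u0; apply: (@abs_not_cube _ _ _ j).
have := ler_distD (y 0 j) (x 0 j) 0; rewrite !subr0.
have : k.+1%:R = k%:R + 1 :> R by rewrite -natr1.
lra.
Qed.

Lemma rV_cons_continuous2 n (t : R) : continuous (fun v : 'rV[R]_n => rV_cons (t, v)).
Proof.
move=> v A /nbhs_ballP[e /= e0 HA]; apply/nbhs_ballP; exists e => //= w [_ wv].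
apply: HA; split=> // i j; rewrite (ord1 i); case: (unliftP ord0 j) => [l ->|->].
  by rewrite !rV_consS /=; exact: wv.
by rewrite !rV_cons0; exact: ballxx.
Qed.

Lemma rV_cons_continuous1 n (v : 'rV[R]_n) : continuous (fun t : R => rV_cons (t, v)).
Proof.
move=> t A /nbhs_ballP[e /= e0 HA]; apply/nbhs_ballP; exists e => //= s st.
apply: HA; split=> // i j; rewrite (ord1 i); case: (unliftP ord0 j) => [l ->|->].
  by rewrite !rV_consS /=; exact: ballxx.
by rewrite !rV_cons0.
Qed.

Lemma rV_cons_line0 n (s t : R) (v : 'rV[R]_n) :
  s *: delta_mx ord0 ord0 + rV_cons (t, v) = rV_cons (s + t, v).
Proof.
apply/rowP => j; case: (unliftP ord0 j) => [l ->|->].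
  by rewrite mxE !rV_consS !mxE /= mulr0 add0r.
by rewrite mxE !rV_cons0 !mxE eqxx /= mulr1.
Qed.

Lemma rV_cons_lineS n (s t : R) (v : 'rV[R]_n) j :
  s *: delta_mx ord0 (lift ord0 j) + rV_cons (t, v) =
  rV_cons (t, s *: delta_mx ord0 j + v).
Proof.
apply/rowP => i; case: (unliftP ord0 i) => [l ->|->].
  by rewrite mxE !rV_consS !mxE (inj_eq lift_inj).
by rewrite mxE !rV_cons0 !mxE /= mulr0 add0r.
Qed.

Lemma cube_cons n k (t : R) (v : 'rV[R]_n) :
  cube k (rV_cons (t, v)) <-> `|t| < k%:R /\ cube k v.
Proof.
split=> [H|[tk H] i].
  split; first by have := H ord0; rewrite rV_cons0 !mxE -ltr_norml.
  by move=> i; have := H (lift ord0 i); rewrite rV_consS !mxE.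
case: (unliftP ord0 i) => [l ->|->].
  by rewrite rV_consS !mxE; have := H l; rewrite !mxE.
by rewrite rV_cons0 !mxE -ltr_norml.
Qed.

Lemma integral1_derive0 (phi dphi : R -> R) k :
  (forall t : R, is_derive t 1 phi (dphi t)) -> continuous dphi ->
  (forall t, k%:R <= `|t| -> phi t = 0) -> (forall t, k%:R <= `|t| -> dphi t = 0) ->
  (\int[lebesgue_measure]_t (dphi t)%:E = 0)%E.
Proof.
move=> dp cdp p0 dp0.
pose K : R := k.+1%:R; have K0 : 0 < K by rewrite ltr0n.
have KK : - K < K by rewrite -subr_gt0 opprK addr_gt0.
have kK : k%:R <= K by rewrite ler_nat.
have cp : continuous phi.
  by move=> t; apply: differentiable_continuous; apply/derivable1_diffP; have [] := dp t.
have pK : phi K = 0 by apply: p0; rewrite gtr0_norm.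
have pNK : phi (- K) = 0 by apply: p0; rewrite normrN gtr0_norm.
transitivity (\int[lebesgue_measure]_(t in `[(- K)%R, K]) (dphi t)%:E)%E.
  rewrite [RHS]integral_mkcond; apply: eq_integral => t _.
  rewrite patchE; case: ifPn => //; rewrite notin_setE /= in_itv /= -ler_norml => /negP.
  by rewrite -ltNge => /ltW Kt; rewrite dp0// (le_trans kK).
rewrite (@continuous_FTC2 _ dphi phi)//.
- by rewrite pK pNK sube0.
- exact: continuous_subspaceT.
- split.
  + by move=> t _; have [] := dp t.
  + by apply: cvg_at_right_filter; exact: cp.
  + by apply: cvg_at_left_filter; exact: cp.
- by move=> t _; rewrite derive1E; have [_ ->] := dp t.
Qed.

(** Integrability over the product of the line and the remaining coordinates, as
    needed to apply Fubini to the recursive definition of the measure. *)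
Lemma integrable_cons n (f : 'rV[R]_n.+1 -> R) k : continuous f -> bsupp k f ->
  (@lebesgue_measure R \x @lebn R n)%E.-integrable setT (EFin \o (f \o @rV_cons R n)).
Proof.
move=> cf f0.
have [M HM] : exists M : R, forall x, `|f x| <= M.
  have : compact (f @` cbox (const_mx (- k%:R)) (const_mx k%:R)).
    apply: continuous_compact; last exact: cbox_compact.
    exact: continuous_subspaceT.
  move=> /compact_bounded[M [_ HM]].
  have M1 : M < `|M| + 1 by rewrite (le_lt_trans (ler_norm _))// ltrDl.
  exists (`|M| + 1) => x; have [xk|xk] := pselect (cube k x); last first.
    by rewrite f0// normr0 addr_ge0.
  by apply: (HM _ M1); exists x => //; exact: box_cbox.
have M0 : 0 <= M by exact: le_trans (HM 0).
have mc : measurable (@rV_cons R n @^-1` cube k).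
  rewrite -[X in measurable X]setTI; apply: measurable_rV_cons => //.
  exact: measurable_box.
have mf : measurable_fun setT (f \o @rV_cons R n).
  apply: measurableT_comp; first exact: continuous_measurable_rV.
  exact: measurable_rV_cons.
have I1 : (@lebesgue_measure R \x @lebn R n)%E.-integrable setT
    (EFin \o \1_(@rV_cons R n @^-1` cube k)).
  apply/integrableP; split; first by apply/measurable_EFinP; exact: measurable_indic.
  under eq_integral do rewrite /= ger0_norm//.
  rewrite integral_indic// setIT.
  exact: (@lebn_cube_lty R n.+1 k).
apply: (le_integrable _ _ _ (integrableZl _ M I1)) => //.
  by apply/measurable_EFinP.
move=> [t v] _ /=; rewrite lee_fin normrM (ger0_norm M0) indicE.
have [xk|xk] := boolP ((t, v) \in @rV_cons R n @^-1` cube k).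
  by rewrite normr1 mulr1 HM.
by rewrite f0 ?normr0 ?mulr0// => H; move: xk; rewrite notin_setE; apply.
Qed.

(** Induction on the dimension. By Fubini one may integrate first over the
    coordinates on which the induction hypothesis applies, or, for the derivative in
    the first coordinate, over that coordinate, where the fundamental theorem of
    calculus applies. *)
Lemma integral_partial0 n (i : 'I_n) k (u : 'rV[R]_n -> R) :
  continuous u -> (forall x, derivable u x (delta_mx ord0 i)) ->
  continuous (partial i u) -> bsupp k u ->
  (\int[@lebn R n]_x (partial i u x)%:E = 0)%E.
Proof.
elim: n i u => [[]//|n IHn] i u cu du cpu u0.
have Ii := integrable_cons cpu (partial_bsupp i u0).
have mp : measurable_fun setT (EFin \o partial i u).
  by apply/measurable_EFinP; exact: continuous_measurable_rV.
have mc : measurable_fun [set: (measurableTypeR R * 'rV[R]_n)%type] (@rV_cons R n).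
  exact: measurable_rV_cons.
have := integral_pushforward mc mp Ii measurableT.
rewrite preimage_setT => E; rewrite [LHS]E {E}.
have Di x : is_derive x (delta_mx ord0 i) u (partial i u x) by split => //; exact: du.
case: (unliftP ord0 i) Di cpu Ii => [j ->|->] Di cpu Ii.
  rewrite -integral12_prod_meas1//=; apply: integral0_eq => t _.
  pose w v := u (rV_cons (t, v)).
  have Dw v : is_derive v (delta_mx ord0 j) w (partial (lift ord0 j) u (rV_cons (t, v))).
    apply/is_derive_line; have /is_derive_line := Di (rV_cons (t, v)).
    by under eq_fun do rewrite rV_cons_lineS.
  have pw : partial j w = (fun v => partial (lift ord0 j) u (rV_cons (t, v))).
    by apply/funext => v; have [_ dw] := Dw v; exact: dw.
  transitivity (\int[@lebn R n]_v (partial j w v)%:E)%E.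
    by apply: eq_integral => v _; rewrite pw.
  apply: IHn.
  - by move=> v; apply: continuous_comp; [exact: rV_cons_continuous2|exact: cu].
  - by move=> v; have [] := Dw v.
  - by rewrite pw => v; apply: continuous_comp; [exact: rV_cons_continuous2|exact: cpu].
  - by move=> v vk; apply: u0 => /cube_cons[].
rewrite -integral21_prod_meas1//=; apply: integral0_eq => v _.
apply: (@integral1_derive0 (fun t => u (rV_cons (t, v))) _ k.+1).
- move=> t; have /is_derive_line := Di (rV_cons (t, v)).
  move=> H; apply/is_derive_line; move: H.
  under eq_fun do rewrite rV_cons_line0.
  by under [X in _ -> is_derive _ _ X _]eq_fun do rewrite [_ *: (1 : R)]mulr1.
- by move=> t; apply: (@continuous_comp _ _ _ (fun t : R => rV_cons (t, v)));
    [exact: rV_cons_continuous1|exact: cpu].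
- move=> t tk; apply: u0 => /cube_cons[].
  by rewrite ltNge (le_trans _ tk)// ler_nat.
- move=> t tk; apply: (partial_bsupp ord0 u0) => /cube_cons[].
  by rewrite ltNge tk.
Qed.

End integral_of_partial.

(** * Semi-inner products *)

Section semi_inner_product.
Context {R : realType} {V : lmodType R}.
Implicit Types (a b : V -> V -> R) (W : set V) (u v w : V).

Definition linsub W := W 0 /\ forall (c : R) u v, W u -> W v -> W (c *: u + v).

(** Linearity is asked for on W only, because the integrals of products of gradients
    are additive in their arguments on Sobolev functions but not on all functions. *)
Definition semi_inner W a :=
  [/\ forall (c : R) u v w, W u -> W v -> W w -> a (c *: u + v) w = c * a u w + a v w,
      forall u v, W u -> W v -> a u v = a v u
    & forall u, W u -> 0 <= a u u].

Lemma linsubD W u v : linsub W -> W u -> W v -> W (u + v).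
Proof. by move=> [_ H] Wu Wv; rewrite -[u]scale1r; apply: H. Qed.

Lemma linsubZ W c u : linsub W -> W u -> W (c *: u).
Proof. by move=> [W0 H] Wu; rewrite -[_ *: _]addr0; apply: H. Qed.

Lemma linsubB W u v : linsub W -> W u -> W v -> W (u - v).
Proof.
by move=> WW Wu Wv; apply: linsubD => //; rewrite -scaleN1r; apply: linsubZ.
Qed.

Lemma linsub_sum W (I : finType) (F : I -> V) :
  linsub W -> (forall i, W (F i)) -> W (\sum_i F i).
Proof.
move=> WW WF; apply: big_ind => //; first by case: WW.
by move=> x y; apply: linsubD.
Qed.

Variables (W : set V) (a : V -> V -> R).
Hypotheses (WW : linsub W) (sa : semi_inner W a).

Lemma siC u v : W u -> W v -> a u v = a v u.
Proof. by move=> Wu Wv; case: sa => _ + _; apply. Qed.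

Lemma si_ge0 u : W u -> 0 <= a u u.
Proof. by move=> Wu; case: sa => _ _; apply. Qed.

Lemma siDl u v w : W u -> W v -> W w -> a (u + v) w = a u w + a v w.
Proof.
by move=> Wu Wv Ww; case: sa => H _ _; rewrite -[u]scale1r H// mul1r scale1r.
Qed.

Lemma si0l w : W w -> a 0 w = 0.
Proof.
move=> Ww; apply: (addrI (a 0 w)).
by rewrite -siDl ?addr0 //; case: WW.
Qed.

Lemma siZl c u w : W u -> W w -> a (c *: u) w = c * a u w.
Proof.
move=> Wu Ww; case: (sa) => H _ _; rewrite -[_ *: _]addr0 H// ?si0l ?addr0//.
by case: WW.
Qed.

Lemma siBl u v w : W u -> W v -> W w -> a (u - v) w = a u w - a v w.
Proof.
move=> Wu Wv Ww; rewrite -scaleN1r siDl ?siZl ?mulN1r//.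
exact: linsubZ.
Qed.

Lemma siDr u v w : W u -> W v -> W w -> a w (u + v) = a w u + a w v.
Proof.
by move=> Wu Wv Ww; rewrite siC ?siDl//; [rewrite !(@siC _ w)|apply: linsubD].
Qed.

Lemma siZr c u w : W u -> W w -> a w (c *: u) = c * a w u.
Proof.
by move=> Wu Ww; rewrite siC ?siZl//; [rewrite (@siC _ w)|apply: linsubZ].
Qed.

Lemma siBr u v w : W u -> W v -> W w -> a w (u - v) = a w u - a w v.
Proof.
by move=> Wu Wv Ww; rewrite siC ?siBl//; [rewrite !(@siC _ w)|apply: linsubB].
Qed.

Lemma si_suml (I : finType) (F : I -> V) w : (forall i, W (F i)) -> W w ->
  a (\sum_i F i) w = \sum_i a (F i) w.
Proof.
move=> WF Ww.
suff [] : W (\sum_i F i) /\ a (\sum_i F i) w = \sum_i a (F i) w by [].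
apply: (big_rec2 (fun x y => W x /\ a x w = y)).
  by split; [case: WW|exact: si0l].
move=> i y x _ [Wx <-]; split; first exact: linsubD.
by rewrite siDl.
Qed.

Lemma si_sum2 (I : finType) (F : I -> V) : (forall i, W (F i)) ->
  a (\sum_i F i) (\sum_i F i) = \sum_i \sum_j a (F i) (F j).
Proof.
move=> WF; have WS : W (\sum_i F i) by exact: linsub_sum.
rewrite si_suml//; apply: eq_bigr => i _.
rewrite siC// si_suml//; apply: eq_bigr => j _; exact: siC.
Qed.

Lemma siBB u v : W u -> W v ->
  a (u - v) (u - v) = a u u - 2 * a u v + a v v.
Proof.
move=> Wu Wv; have Wuv : W (u - v) by apply: linsubB.
by rewrite siBl// !siBr// (siC Wv Wu); ring.
Qed.

Lemma siZZ c u : W u -> a (c *: u) (c *: u) = c ^+ 2 * a u u.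
Proof.
by move=> Wu; rewrite siZl// ?siZr//; [ring|apply: linsubZ].
Qed.

Lemma siNN u v : W u -> W v -> a (u - v) (u - v) = a (v - u) (v - u).
Proof.
by move=> Wu Wv; rewrite -(opprB v u) -[- (v - u)]scaleN1r siZZ ?sqrrN ?expr1n ?mul1r//; apply: linsubB.
Qed.

Lemma si_CS u v : W u -> W v -> a u v ^+ 2 <= a u u * a v v.
Proof.
move=> Wu Wv.
have H t : 0 <= a u u - 2 * t * a u v + t ^+ 2 * a v v.
  have := si_ge0 (linsubB WW Wu (linsubZ t WW Wv)).
  rewrite siBB//; last exact: linsubZ.
  by rewrite siZr// siZZ// mulrA.
have [v0|v0] := eqVneq (a v v) 0.
  rewrite v0 mulr0; have [->|uv0] := eqVneq (a u v) 0; first by rewrite expr0n.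
  have := H ((a u u + 1) / (2 * a u v)).
  have -> : 2 * ((a u u + 1) / (2 * a u v)) * a u v = a u u + 1 by field.
  by rewrite v0; lra.
have vp : 0 < a v v by rewrite lt_def v0 si_ge0.
have := H (a u v / a v v).
have -> : a u u - 2 * (a u v / a v v) * a u v + (a u v / a v v) ^+ 2 * a v v
  = (a u u * a v v - a u v ^+ 2) / a v v by field.
by rewrite pmulr_lge0 ?invr_gt0// subr_ge0.
Qed.

Definition nrm a u := Num.sqrt (a u u).

Lemma nrm_sqr u : W u -> nrm a u ^+ 2 = a u u.
Proof. by move=> Wu; rewrite sqr_sqrtr// si_ge0. Qed.

Lemma nrm_ge0 u : 0 <= nrm a u. Proof. exact: sqrtr_ge0. Qed.

Lemma si_nrm u v : W u -> W v -> a u v <= nrm a u * nrm a v.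
Proof.
move=> Wu Wv; rewrite -sqrtrM ?si_ge0//.
apply: le_trans (ler_norm _) _; rewrite -sqrtr_sqr ler_sqrt; first exact: si_CS.
by rewrite mulr_ge0// si_ge0.
Qed.

Lemma si_ker u v : W u -> W v -> a u u = 0 -> a u v = 0.
Proof.
move=> Wu Wv u0; have := si_CS Wu Wv; rewrite u0 mul0r => H.
by apply/eqP; rewrite -sqrf_eq0 eq_le H sqr_ge0.
Qed.

Lemma siBB_ker u v : W u -> W v -> a v v = 0 -> a (u - v) (u - v) = a u u.
Proof.
by move=> Wu Wv v0; rewrite siBB// (siC Wu Wv) (si_ker Wv Wu v0) v0; ring.
Qed.

Lemma siBB_nrm u v : W u -> W v ->
  a (u - v) (u - v) <= (nrm a u + nrm a v) ^+ 2.
Proof.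
move=> Wu Wv; rewrite siBB// sqrrD !nrm_sqr//.
have := si_nrm Wu (linsubZ (-1) WW Wv); rewrite siZr// /nrm siZZ//.
rewrite sqrrN expr1n !mul1r mulr2n; lra.
Qed.

Lemma siB3 u v w : W u -> W v -> W w ->
  a (u - v - w) (u - v - w) <= 3 * (a u u + a v v + a w w).
Proof.
move=> Wu Wv Ww.
have H1 := si_ge0 (linsubD WW (linsubD WW Wu Wv) (linsubZ 0 WW Wv)).
have := si_ge0 (linsubD WW Wu Wv).
have := si_ge0 (linsubD WW Wu Ww).
have := si_ge0 (linsubB WW Wv Ww).
have Wuv : W (u - v) by apply: linsubB.
have Duv : W (u + v) by apply: linsubD.
have Duw : W (u + w) by apply: linsubD.
rewrite !siBB// siBl// !siDl// !siDr// (siC Wv Wu) (siC Ww Wu).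
lra.
Qed.

(** Orthogonal decomposition along v: the difference splits by Pythagoras into its
    component along v and a remainder, to which the triangle inequality applies. *)
Lemma siBB_proj u w v : W u -> W w -> W v -> 0 < a v v ->
  [/\ 0 <= a u u - a u v ^+ 2 / a v v, 0 <= a w w - a w v ^+ 2 / a v v
  & a (u - w) (u - w) <= (a u v - a w v) ^+ 2 / a v v +
   (Num.sqrt (a u u - a u v ^+ 2 / a v v) +
    Num.sqrt (a w w - a w v ^+ 2 / a v v)) ^+ 2].
Proof.
move=> Wu Ww Wv vp; have v0 : a v v != 0 by rewrite gt_eqF.
pose P x := x - (a x v / a v v) *: v.
have WP x : W x -> W (P x) by move=> Wx; apply: linsubB => //; apply: linsubZ.
have PP x : W x -> a (P x) (P x) = a x x - a x v ^+ 2 / a v v.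
  move=> Wx; rewrite siBB//; last exact: linsubZ.
  by rewrite siZr// siZZ//; field.
split; rewrite -?PP ?si_ge0//; try exact: WP.
apply: le_trans (lerD (lexx _) (siBB_nrm (WP _ Wu) (WP _ Ww))).
have -> : P u - P w = P (u - w).
  rewrite /P siBl// mulrBl scalerBl !opprB -!addrA.
  by congr (_ + _); rewrite addrCA [RHS]addrCA [- _ - w]addrC.
rewrite PP ?(siBl Wu Ww Wv)//; last exact: linsubB.
by rewrite [leRHS]addrC subrK.
Qed.

End semi_inner_product.

(** * Square roots of positive semidefinite matrices *)

Lemma interpolation_exists (F : fieldType) (s : seq F) (f : F -> F) :
  exists p : {poly F}, forall x, x \in s -> p.[x] = f x.
Proof.
elim: s => [|a s [p Hp]]; first by exists 0.
have [sa|sa] := boolP (a \in s).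
  by exists p => x; rewrite inE => /predU1P[->|]; exact: Hp.
pose q := \prod_(y <- s) ('X - y%:P).
have qa : q.[a] != 0 by rewrite -/(root q a) root_prod_XsubC.
exists (p + ((f a - p.[a]) / q.[a]) *: q) => x.
rewrite hornerD hornerZ inE => /predU1P[->|xs]; first by rewrite divfK// addrC subrK.
have /rootP -> : root q x by rewrite root_prod_XsubC.
by rewrite mulr0 addr0 Hp.
Qed.

Lemma trmx_horner_mx (F : comNzRingType) n (A : 'M[F]_n.+1) (p : {poly F}) :
  (horner_mx A p)^T = horner_mx A^T p.
Proof.
elim/poly_ind: p => [|p c IHp]; first by rewrite !rmorph0 trmx0.
rewrite !rmorphD !rmorphM /= !horner_mx_X !horner_mx_C linearD /= tr_scalar_mx.
rewrite -mulmxE trmx_mul IHp; congr (_ + _).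
by rewrite (comm_mx_sym (comm_mx_horner _ _))//; exact: comm_mx_refl.
Qed.

Lemma horner_mx_diagonalized (F : fieldType) n (P A : 'M[F]_n.+1) d (p : {poly F}) :
  P \in unitmx -> A = invmx P *m diag_mx d *m P ->
  (forall i, p.[d 0 i] = d 0 i) -> horner_mx A p = A.
Proof.
move=> Pu -> pd; rewrite horner_mx_uconjC// horner_mx_diag.
by congr (_ *m diag_mx _ *m _); apply/rowP => i; rewrite !mxE.
Qed.

Section real_symmetric.
Context {R : realType}.
Notation C := R[i].

Lemma dot_ge0 d (x : 'rV[R]_d) : 0 <= dot x x.
Proof.
by rewrite /dot mxE sumr_ge0// => i _; rewrite mxE -expr2 sqr_ge0.
Qed.

Lemma dot_eq0 d (x : 'rV[R]_d) : dot x x = 0 -> x = 0.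
Proof.
rewrite /dot mxE => /eqP; rewrite psumr_eq0; last first.
  by move=> i _; rewrite mxE -expr2 sqr_ge0.
move=> /allP H; apply/rowP => i; have := H i (mem_index_enum i).
by rewrite /= !mxE -expr2 sqrf_eq0 => /eqP.
Qed.

(** If the real polynomial r sends each eigenvalue l to the fourth root of l, then
    r(M) ^ 4 = M since M is unitarily diagonalizable over the complex numbers, and
    S = r(M) ^ 2 is a square root of M. It is real and symmetric, being a real
    polynomial in M, and positive, being the square of a symmetric matrix. *)
Lemma psd_sqrt_exists d (M : 'M[R]_d) : M^T = M ->
  (forall xi, 0 <= dot xi (mxapp M xi)) ->
  exists S : 'M[R]_d,
    [/\ S^T = S, forall xi, 0 <= dot xi (mxapp S xi) & S *m S = M].
Proof.
case: d M => [|d] M MT Mp.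
  exists 0; split; [by rewrite trmx0| |by apply/matrixP => -[]].
  by move=> xi; rewrite /dot mxE big_ord0.
pose f : {rmorphism R -> C} := real_complex R.
pose Mc := map_mx f M.
have Mh : Mc \is hermsymmx.
  apply/is_hermitianmxP; rewrite expr0 scale1r; apply/matrixP => i j.
  by rewrite !mxE -[in LHS]MT mxE conj_Creal// complex_real.
have Mn := hermitian_normalmx Mh.
have /orthomx_spectralP := Mn.
set P := spectralmx Mc; set sp := spectral_diag Mc => ME.
have Pu : P \in unitmx by exact: spectral_unit.
have /mxOverP spR := hermitian_spectral_diag_real Mh.
have spE i : exists2 l : R, sp 0 i = f l & 0 <= l.
  have [l lE] : exists l : R, sp 0 i = f l.
    by exists (complex.Re (sp 0 i)); rewrite /f /= RRe_real.
  exists l => //.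
  (* A real eigenvalue of the complexified matrix has a real eigenvector, on
     which positivity can be tested. *)
  have : eigenvalue Mc (f l).
    apply/eigenvalueP; exists (row i P).
      rewrite -row_mul ME mulmxA mulmxA mulmxV// mul1mx row_mul.
      by rewrite row_diag_mx -scalemxAl -rowE lE.
    apply/negP => /eqP r0.
    have : row i (P *m invmx P) = 0 by rewrite row_mul r0 mul0mx.
    rewrite mulmxV// => /rowP/(_ i); rewrite !mxE eqxx => /eqP.
    by rewrite oner_eq0.
  rewrite eigenvalue_root_char -map_char_poly fmorph_root -eigenvalue_root_char.
  move=> /eigenvalueP[v vM v0].
  have := Mp v; rewrite /mxapp MT vM /dot linearZ /= -scalemxAr mxE.
  rewrite pmulr_lge0// lt_def; rewrite -/(dot v v) dot_ge0 andbT.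
  by apply: contra v0 => /eqP/dot_eq0 ->.
pose l i := complex.Re (sp 0 i).
have lE i : sp 0 i = f (l i) by have [x E _] := spE i; rewrite /l E.
have l0 i : 0 <= l i by have [x E x0] := spE i; rewrite /l E.
have [r Hr] := interpolation_exists [seq l i | i <- enum 'I_d.+1]
  (fun x => Num.sqrt (Num.sqrt x)).
have Hr4 i : r.[l i] ^+ 4 = l i.
  rewrite Hr; last by apply: map_f; rewrite mem_enum.
  by rewrite (exprM _ 2 2) !sqr_sqrtr// sqrtr_ge0.
pose T := horner_mx M r.
have TT : T^T = T by rewrite /T trmx_horner_mx MT.
have T4 : T *m T *m (T *m T) = M.
  apply: (@map_mx_inj _ _ f).
  have -> : T *m T *m (T *m T) = horner_mx M (r ^+ 4).
    by rewrite rmorphXn /= -/T !mulmxE -!expr2 -exprM.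
  rewrite map_horner_mx; apply: (horner_mx_diagonalized Pu ME) => i.
  by rewrite lE horner_map horner_exp Hr4.
exists (T *m T); split => //; first by rewrite trmx_mul TT.
move=> xi; suff -> : dot xi (mxapp (T *m T) xi) = dot (xi *m T) (xi *m T).
  exact: dot_ge0.
by rewrite /dot /mxapp trmx_mul trmxK trmx_mul TT !mulmxA.
Qed.

Lemma enorm_sqrtmx d (M : 'M[R]_d) xi : M^T = M ->
  (forall xi, 0 <= dot xi (mxapp M xi)) ->
  enorm (mxapp (sqrtmx M) xi) ^+ 2 = dot (mxapp M xi) xi.
Proof.
move=> MT Mp; rewrite /sqrtmx.
case: xgetP => [S _ [ST Sp SS]|H]; last first.
  by have [S HS] := psd_sqrt_exists MT Mp; case: (H S).
rewrite /enorm sqr_sqrtr ?dot_ge0// /dot /mxapp ST MT trmx_mul ST.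
by rewrite mulmxA -(mulmxA xi S S) SS.
Qed.

End real_symmetric.

(** * Weak gradients and the spaces H^1 and H^1_0 *)

Section sobolev.
Context {R : realType} {d : nat}.
Notation lam := (@lebn R d).
Implicit Types (U D : set 'rV[R]_d) (u v g h phi psi : 'rV[R]_d -> R).

Lemma test_fun_continuous U phi : test_fun U phi -> continuous phi.
Proof. by move=> [/(_ 0%N) [] //]. Qed.

Lemma test_fun_derivable U phi i x : test_fun U phi ->
  derivable phi x (delta_mx ord0 i).
Proof. by move=> [/(_ 1%N) [_ /(_ i) [H _]] _ _]; exact: H. Qed.

Lemma test_fun_csupp U phi : test_fun U phi -> csupp phi.
Proof. by case. Qed.

Lemma test_fun_out U phi x : test_fun U phi -> ~ U x -> phi x = 0.
Proof.
move=> [_ _ sU] Ux; apply: contrapT => /eqP px; apply: Ux; apply: sU.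
exact: subset_closure.
Qed.

Lemma closure_support_partial i phi :
  closure [set x | partial i phi x != 0] `<=` closure [set x | phi x != 0].
Proof.
have -> : closure [set x | phi x != 0] = closure (closure [set x | phi x != 0]).
  by have /closure_id := @closed_closure _ [set x | phi x != 0].
apply: closureS => x /= px; apply: contrapT => xs; move/eqP: px; apply.
rewrite /partial (@near_eq_derive _ _ _ _ (cst 0)); first exact: derive_cst.
have : open_nbhs x (~` closure [set x | phi x != 0]).
  by split=> //; exact/closed_openC/closed_closure.
move=> /open_nbhs_nbhs; apply: filterS => y /= ys; apply: contrapT => /eqP py.
by apply: ys; exact: subset_closure.
Qed.

Lemma test_fun_partial U i phi : test_fun U phi -> test_fun U (partial i phi).
Proof.
move=> [Ckp cp sp]; have S := @closure_support_partial i phi; split.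
- by move=> k; have [_ /(_ i) []] := Ckp k.+1.
- by apply: subclosed_compact cp S; exact: closed_closure.
- exact: subset_trans S sp.
Qed.

Lemma test_fun_lin U (c : R) phi psi : test_fun U phi -> test_fun U psi ->
  test_fun U (c *: phi + psi).
Proof.
move=> [C1 k1 s1] [C2 k2 s2].
have S : closure [set x | (c *: phi + psi) x != 0] `<=`
   closure [set x | phi x != 0] `|` closure [set x | psi x != 0].
  rewrite -closureU; apply: closureS => x /=; rewrite !fctE /= => H.
  have [p0|] := eqVneq (phi x) 0; last by left.
  by right; move: H; rewrite p0 scaler0 add0r.
split.
- move=> k; apply: CkD => //; rewrite (_ : c *: phi = cst c * phi)//.
  by apply: CkM => //; exact: Ck_cst.
- by apply: subclosed_compact S; [exact: closed_closure|exact: compactU].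
- by apply: subset_trans S _ => x [/s1|/s2].
Qed.

Lemma L2_test_fun U D phi : measurable D -> test_fun U phi -> L2 D phi.
Proof.
move=> mD tp; apply: L2_csupp => //; first exact: test_fun_continuous tp.
exact: test_fun_csupp tp.
Qed.

(** The product of two test functions is a test function, so that the integral of
    its derivative vanishes. *)
Lemma test_fun_ibp U i phi psi : measurable U -> test_fun U phi -> test_fun U psi ->
  \int[lam]_(x in U) (phi x * partial i psi x) =
  - \int[lam]_(x in U) (partial i phi x * psi x).
Proof.
move=> mU tp tq; have tdp := test_fun_partial i tp; have tdq := test_fun_partial i tq.
have mul1 : lam.-integrable U (EFin \o (fun x => phi x * partial i psi x)).
  by apply: L2_integrable_mul; [|exact: L2_test_fun tp|exact: L2_test_fun tdq].
have mul2 : lam.-integrable U (EFin \o (fun x => partial i phi x * psi x)).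
  by apply: L2_integrable_mul; [|exact: L2_test_fun tdp|exact: L2_test_fun tq].
apply/eqP; rewrite -subr_eq0 opprK -RintegralD//; apply/eqP.
have [k Hk] := csupp_cube (test_fun_csupp tp).
have dM x : derivable (phi * psi) x (delta_mx ord0 i).
  by apply: derivableM; [exact: test_fun_derivable tp|exact: test_fun_derivable tq].
have pM : partial i (phi * psi) = (fun x => phi x * partial i psi x + partial i phi x * psi x).
  apply/funext => x; rewrite /partial deriveM//; last 2 first.
    exact: test_fun_derivable tp.
    exact: test_fun_derivable tq.
  by rewrite /GRing.scale /= [psi x * _]mulrC.
have Ck2 : Ck 1 (phi * psi).
  by have [C1 _ _] := tp; have [C2 _ _] := tq; apply: CkM.
have := @integral_partial0 R d i k (phi * psi).
move=> /(_ (Ck_continuous Ck2) dM); rewrite pM => H.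
rewrite Rintegral_mkcond /Rintegral.
rewrite (eq_integral (fun x => (phi x * partial i psi x + partial i phi x * psi x)%:E)).
  rewrite H//; first by rewrite -pM; have [_ /(_ i) [_ [] //]] := Ck2.
  by move=> x xk; rewrite !fctE /= Hk// mul0r.
move=> x _; rewrite patchE; case: ifPn => //; rewrite notin_setE => Ux.
by rewrite (test_fun_out tp Ux) (test_fun_out tq Ux) mul0r mulr0 addr0.
Qed.

Lemma test_fun_weak_partial U i phi : measurable U -> test_fun U phi ->
  weak_partial U i phi (partial i phi).
Proof. by move=> mU tp psi tq; exact: test_fun_ibp. Qed.

(** Needed for sums of approximating sequences: the weak gradient is the
    default value zero for functions outside H^1, hence it is linear on differences
    of test functions and H^1 functions only because test functions are in H^1. *)
Lemma H1_test_fun U phi : measurable U -> test_fun U phi -> H1 U phi.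
Proof.
move=> mU tp; split; first exact: L2_test_fun tp.
move=> i; exists (partial i phi); split; last exact: test_fun_weak_partial.
by apply: L2_test_fun => //; exact: test_fun_partial tp.
Qed.

Lemma wpartialP U i u : H1 U u -> L2 U (wpartial U i u) /\ weak_partial U i u (wpartial U i u).
Proof.
move=> [_ /(_ i) [g Hg]]; rewrite /wpartial; case: xgetP => [h _ //|/(_ g)//].
Qed.

Lemma weak_partial_lin U i (c : R) u v g h : measurable U ->
  L2 U u -> L2 U v -> L2 U g -> L2 U h ->
  weak_partial U i u g -> weak_partial U i v h -> weak_partial U i (c *: u + v) (c *: g + h).
Proof.
move=> mU Lu Lv Lg Lh Hu Hv phi tp; have tdp := test_fun_partial i tp.
have E w z : (fun x => (c *: w + z) x * phi x) = (fun x => c * (w x * phi x) + z x * phi x).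
  by apply/funext => x; rewrite !fctE /= /GRing.scale /= mulrDl mulrA.
have E' w z : (fun x => (c *: w + z) x * partial i phi x) =
    (fun x => c * (w x * partial i phi x) + z x * partial i phi x).
  by apply/funext => x; rewrite !fctE /= /GRing.scale /= mulrDl mulrA.
have Lp : L2 U phi by exact: L2_test_fun tp.
have Ldp : L2 U (partial i phi) by exact: L2_test_fun tdp.
rewrite E E' !RintegralD ?RintegralZl ?Hu ?Hv//; first by rewrite mulrN opprD.
all: try exact: L2_integrable_mul.
all: by apply: integrableZl_EFin => //; exact: L2_integrable_mul.
Qed.

(** The difference of two weak derivatives is orthogonal to all test functions. *)
Lemma weak_partial_unique U i u g h : open U -> L2 U g -> L2 U h ->
  weak_partial U i u g -> weak_partial U i u h ->
  {ae lam, forall x, U x -> g x = h x}.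
Proof.
move=> oU Lg Lh Hg Hh; have mU := open_measurable_rV oU.
have L : L2 U ((-1) *: h + g) by exact: L2_lin.
have H phi : test_fun U phi -> \int[lam]_(x in U) (((-1) *: h + g) x * phi x) = 0.
  move=> tp; have Lp : L2 U phi by exact: L2_test_fun tp.
  have E : (fun x => ((-1) *: h + g) x * phi x) = (fun x => -1 * (h x * phi x) + g x * phi x).
    by apply/funext => x; rewrite !fctE /= /GRing.scale /= mulrDl mulrA.
  rewrite E RintegralD ?RintegralZl//.
  - have := Hg _ tp; rewrite (Hh _ tp) mulN1r => ->.
    by rewrite addNr.
  - exact: L2_integrable_mul.
  - by apply: integrableZl_EFin => //; exact: L2_integrable_mul.
  - exact: L2_integrable_mul.
apply: filterS (ae_eq0_of_test_fun oU L H) => x Hx Ux.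
by have := Hx Ux; rewrite !fctE /= /GRing.scale /= mulN1r addrC => /subr0_eq.
Qed.

Lemma wpartial_ae U i u g : open U -> H1 U u -> L2 U g -> weak_partial U i u g ->
  {ae lam, forall x, U x -> wpartial U i u x = g x}.
Proof.
move=> oU Hu Lg Hg; have [Lw Hw] := wpartialP i Hu.
exact: weak_partial_unique Hw Hg.
Qed.

Lemma H1_lin U (c : R) u v : measurable U -> H1 U u -> H1 U v -> H1 U (c *: u + v).
Proof.
move=> mU Hu Hv; split; first by apply: L2_lin => //; [case: Hu|case: Hv].
move=> i; have [Lu wu] := wpartialP i Hu; have [Lv wv] := wpartialP i Hv.
exists (c *: wpartial U i u + wpartial U i v); split; first exact: L2_lin.
by apply: weak_partial_lin => //; [case: Hu|case: Hv].
Qed.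

Lemma H1_0 U : measurable U -> H1 U 0.
Proof.
move=> mU; have L0 : L2 U (0 : 'rV[R]_d -> R).
  apply: (@L2_bounded R d U 0 0 0%N) => //; first exact: measurable_cst.
  by move=> x _; rewrite normr0.
split => // i; exists 0; split => // phi _.
have E psi : \int[lam]_(x in U) ((0 : 'rV[R]_d -> R) x * psi x) = 0.
  rewrite (@eq_Rintegral _ _ _ _ _ (cst 0)) ?Rintegral_cst ?mul0r//.
  by move=> x _; rewrite /= mul0r.
by rewrite !E oppr0.
Qed.

Lemma H1_linsub U : measurable U -> linsub (H1 U).
Proof. by move=> mU; split; [exact: H1_0|move=> *; exact: H1_lin]. Qed.

Lemma wpartial_lin U i (c : R) u v : open U -> H1 U u -> H1 U v ->
  {ae lam, forall x, U x ->
    wpartial U i (c *: u + v) x = c * wpartial U i u x + wpartial U i v x}.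
Proof.
move=> oU Hu Hv; have mU := open_measurable_rV oU.
have [Lu wu] := wpartialP i Hu; have [Lv wv] := wpartialP i Hv.
apply: (@wpartial_ae U i _ (c *: wpartial U i u + wpartial U i v)) => //.
- exact: H1_lin.
- exact: L2_lin.
- by apply: weak_partial_lin => //; [case: Hu|case: Hv].
Qed.

Lemma grad_lin U (c : R) u v : open U -> H1 U u -> H1 U v ->
  {ae lam, forall x, U x -> grad U (c *: u + v) x = c *: grad U u x + grad U v x}.
Proof.
move=> oU Hu Hv.
have : {ae lam, forall x, forall i : 'I_d, U x ->
    wpartial U i (c *: u + v) x = c * wpartial U i u x + wpartial U i v x}.
  by apply: filter_forall => i; exact: wpartial_lin.
apply: filterS => x H Ux; apply/rowP => i.
by rewrite !mxE H.
Qed.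

Lemma dotE (x y : 'rV[R]_d) : dot x y = \sum_i x 0 i * y 0 i.
Proof. by rewrite /dot mxE; apply: eq_bigr => i _; rewrite mxE. Qed.

Lemma measurable_grad_dot U u : H1 U u ->
  measurable_fun U (fun x => dot (grad U u x) (grad U u x)).
Proof.
move=> Hu; under eq_fun do rewrite dotE.
apply: measurable_sum => i; under eq_fun do rewrite mxE.
by apply: measurable_funM; have [[]] := wpartialP i Hu.
Qed.

Lemma dot_lin_sqr_le (c : R) (x y : 'rV[R]_d) :
  dot (c *: x + y) (c *: x + y) <= 2 * c ^+ 2 * dot x x + 2 * dot y y.
Proof.
rewrite !dotE !mulr_sumr -big_split /= ler_sum// => i _; rewrite !mxE.
have := sqr_ge0 (c * x 0 i - y 0 i); rewrite !expr2; lra.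
Qed.

Lemma H1_sqnorm_ge0 U u : (0 <= H1_sqnorm U u)%E.
Proof.
by apply: integral_ge0 => x _; rewrite lee_fin addr_ge0 ?sqr_ge0 ?dot_ge0.
Qed.

Lemma H1_sqnorm_lin U (c : R) u v : open U -> H1 U u -> H1 U v ->
  (H1_sqnorm U (c *: u + v)%R <=
   (2 * c ^+ 2)%:E * H1_sqnorm U u + 2%:E * H1_sqnorm U v)%E.
Proof.
move=> oU Hu Hv; have mU := open_measurable_rV oU.
have Hw : H1 U (c *: u + v) by exact: H1_lin.
have m w : H1 U w -> measurable_fun U (fun x => (w x ^+ 2 + dot (grad U w x) (grad U w x))%:E).
  move=> H; apply/measurable_EFinP; apply: measurable_funD.
    by apply: measurable_funX; case: H => [[]].
  exact: measurable_grad_dot.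
have p w x : (0 <= (w x ^+ 2 + dot (grad U w x) (grad U w x))%:E)%E.
  by rewrite lee_fin addr_ge0 ?sqr_ge0 ?dot_ge0.
rewrite /H1_sqnorm -!ge0_integralZl//; try by [exact: m|rewrite lee_fin mulr_ge0 ?sqr_ge0].
rewrite -ge0_integralD//; last 4 first.
- by move=> x _; rewrite mule_ge0// lee_fin mulr_ge0 ?sqr_ge0.
- by apply: measurable_funeM; exact: m.
- by move=> x _; rewrite mule_ge0.
- by apply: measurable_funeM; exact: m.
apply: ae_ge0_le_integral => //.
- exact: m.
- by move=> x _; rewrite adde_ge0// mule_ge0// lee_fin mulr_ge0 ?sqr_ge0.
- by apply: emeasurable_funD; apply: measurable_funeM; exact: m.
apply: filterS (grad_lin c oU Hu Hv) => x Hx Ux; rewrite Hx//.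
rewrite -!EFinM -EFinD lee_fin.
have := dot_lin_sqr_le c (grad U u x) (grad U v x).
rewrite !fctE /= /GRing.scale /=.
have := sqr_ge0 (c * u x - v x); rewrite !expr2; lra.
Qed.

Lemma cvge0_comb (a b : nat -> \bar R) (x y : R) :
  a @ \oo --> 0%E -> b @ \oo --> 0%E ->
  (fun n => x%:E * a n + y%:E * b n)%E @ \oo --> 0%E.
Proof.
move=> ca cb.
have ca' := @cvgeZl _ _ _ a 0%E x%:E isT ca.
have cb' := @cvgeZl _ _ _ b 0%E y%:E isT cb.
rewrite !mule0 in ca' cb'.
by have := cvgeD _ ca' cb'; rewrite adde0; apply.
Qed.

Lemma H10_lin U (c : R) u v : open U -> H10 U u -> H10 U v -> H10 U (c *: u + v).
Proof.
move=> oU [Hu [p [tp cp]]] [Hv [q [tq cq]]]; have mU := open_measurable_rV oU.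
split; first exact: H1_lin.
exists (fun n => c *: p n + q n); split; first by move=> n; exact: test_fun_lin.
have HB w n r : H1 U w -> (forall n, test_fun U (r n)) -> H1 U (r n - w).
  move=> Hw tr; rewrite addrC -scaleN1r; apply: H1_lin => //.
  exact: H1_test_fun.
have E n : c *: p n + q n - (c *: u + v) = c *: (p n - u) + (q n - v).
  by rewrite scalerBr opprD addrACA.
under eq_fun do rewrite E.
apply: (@squeeze_cvge _ _ _ _ (cst 0%E) _ (fun n => (2 * c ^+ 2)%:E * H1_sqnorm U (p n - u)%R +
   2%:E * H1_sqnorm U (q n - v)%R)%E).
- apply: nearW => n; rewrite H1_sqnorm_ge0/=; apply: H1_sqnorm_lin => //; exact: HB.
- exact: cvg_cst.
- exact: cvge0_comb cp cq.
Qed.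

Lemma H10ext_lin U (c : R) u v : open U -> H10ext U u -> H10ext U v -> H10ext U (c *: u + v).
Proof.
move=> oU [Hu u0] [Hv v0]; split; first exact: H10_lin.
by move=> x Ux; rewrite !fctE /= u0// v0// scaler0 addr0.
Qed.

End sobolev.

(** * Energy forms *)

Section integral_tools.
Context {R : realType} {d : nat}.
Notation lam := (@lebn R d).
Implicit Types (D : set 'rV[R]_d) (f g : 'rV[R]_d -> R).

Lemma integrable_measurable D f : lam.-integrable D (EFin \o f) -> measurable_fun D f.
Proof. by move=> /(measurable_int lam)/measurable_EFinP. Qed.

Lemma ae_eq_Rintegral D f g : measurable D -> measurable_fun D f -> measurable_fun D g ->
  {ae lam, forall x, D x -> f x = g x} ->
  \int[lam]_(x in D) f x = \int[lam]_(x in D) g x.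
Proof.
move=> mD mf mg fg; rewrite /Rintegral; congr fine.
apply: ae_eq_integral => //; [exact/measurable_EFinP|exact/measurable_EFinP|].
by apply: filterS fg => x H Dx; rewrite H.
Qed.

Lemma ae_le_Rintegral D f g : measurable D ->
  lam.-integrable D (EFin \o f) -> lam.-integrable D (EFin \o g) ->
  {ae lam, forall x, D x -> f x <= g x} ->
  \int[lam]_(x in D) f x <= \int[lam]_(x in D) g x.
Proof.
move=> mD If Ig fg; rewrite -subr_ge0 -RintegralB//.
have mf := integrable_measurable If; have mg := integrable_measurable Ig.
have mB : measurable_fun D (fun x => g x - f x) by exact: measurable_funB.
rewrite (@ae_eq_Rintegral D _ (fun x => Num.max (g x - f x) 0))//.
- by apply: Rintegral_ge0 => x _; rewrite le_max lexx orbT.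
- exact: measurable_maxr.
- by apply: filterS fg => x H Dx; rewrite max_l// subr_ge0 H.
Qed.

Lemma integrable_sum_EFin D I (r : seq I) (F : I -> 'rV[R]_d -> R) : measurable D ->
  (forall i, lam.-integrable D (EFin \o F i)) ->
  lam.-integrable D (EFin \o (fun x => \sum_(i <- r) F i x)).
Proof.
move=> mD IF; rewrite (_ : _ \o _ = (fun x => \sum_(i <- r) (EFin \o F i) x)%E).
  by apply: integrable_sum => // i _; exact: IF.
by apply/funext => x /=; rewrite sumEFin.
Qed.

Lemma Rintegral_sum D I (r : seq I) (F : I -> 'rV[R]_d -> R) : measurable D ->
  (forall i, lam.-integrable D (EFin \o F i)) ->
  \int[lam]_(x in D) (\sum_(i <- r) F i x) = \sum_(i <- r) \int[lam]_(x in D) F i x.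
Proof.
move=> mD IF; elim: r => [|i r IHr].
  rewrite big_nil; under eq_Rintegral do rewrite big_nil.
  by rewrite Rintegral_cst// mul0r.
rewrite big_cons; under eq_Rintegral do rewrite big_cons.
by rewrite RintegralD ?IHr//; exact: integrable_sum_EFin.
Qed.

End integral_tools.

Section pointwise.
Context {R : realType} {d : nat}.
Implicit Types (M : 'M[R]_d) (x y z : 'rV[R]_d).

Lemma dot_linl c x y z : dot (c *: x + y) z = c * dot x z + dot y z.
Proof. by rewrite /dot mulmxDl -scalemxAl !mxE. Qed.

Lemma dot_sym x y : dot x y = dot y x.
Proof. by rewrite !dotE; apply: eq_bigr => i _; rewrite mulrC. Qed.

Lemma mxapp_lin M c x y : mxapp M (c *: x + y) = c *: mxapp M x + mxapp M y.
Proof. by rewrite /mxapp mulmxDl -scalemxAl. Qed.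

Lemma mxapp_sym M x y : M^T = M -> dot (mxapp M x) y = dot (mxapp M y) x.
Proof.
move=> MT; rewrite /dot /mxapp MT.
have -> : (x *m M *m y^T) = (x *m M *m y^T)^T.
  by apply/matrixP => i j; rewrite [RHS]mxE !ord1.
by rewrite trmx_mul trmxK trmx_mul MT mulmxA.
Qed.

Lemma mxapp1 x : mxapp 1%:M x = x.
Proof. by rewrite /mxapp trmx1 mulmx1. Qed.

Lemma dot_mxappE M x y : dot (mxapp M x) y = \sum_i (\sum_j x 0 j * M i j) * y 0 i.
Proof.
rewrite dotE; apply: eq_bigr => i _; congr (_ * _).
by rewrite mxE; apply: eq_bigr => j _; rewrite mxE.
Qed.

Lemma enorm_sqr x : enorm x ^+ 2 = dot x x.
Proof. by rewrite sqr_sqrtr// dot_ge0. Qed.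

(** Expand the quadratic form at x + y and at y - x, where it is nonnegative. *)
Lemma mxapp_Young M x y : M^T = M -> (forall z, 0 <= dot (mxapp M z) z) ->
  `|dot (mxapp M x) y| <= (dot (mxapp M x) x + dot (mxapp M y) y) / 2.
Proof.
move=> MT Mp.
have H c : dot (mxapp M (c *: x + y)) (c *: x + y) =
  c ^+ 2 * dot (mxapp M x) x + 2 * c * dot (mxapp M x) y + dot (mxapp M y) y.
  rewrite mxapp_lin dot_linl !(dot_sym _ (c *: x + y)) !dot_linl.
  rewrite !(dot_sym _ (mxapp M _)) (mxapp_sym y x MT); ring.
have := Mp (1 *: x + y); have := Mp ((-1) *: x + y); rewrite !H ler_norml expr1n sqrrN expr1n => h1 h2.
by apply/andP; split; lra.
Qed.

End pointwise.

Section forms.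
Context {R : realType} {d : nat}.
Notation lam := (@lebn R d).
Variables (Omega : set 'rV[R]_d) (B : 'rV[R]_d -> 'M[R]_d) (al be : R).
Hypotheses (oO : open Omega) (al0 : 0 < al).
Hypothesis mB : forall i j, measurable_fun Omega (fun x => B x i j).
Hypothesis BT : forall x, Omega x -> (B x)^T = B x.
Hypothesis Bell : forall x, Omega x -> forall xi,
  al * enorm xi ^+ 2 <= dot xi (mxapp (B x) xi) <= be * enorm xi ^+ 2.
Implicit Types (D : set 'rV[R]_d) (u v w : 'rV[R]_d -> R).

Let mO : measurable Omega := open_measurable_rV oO.

Definition energy u v x := dot (mxapp (B x) (grad Omega u x)) (grad Omega v x).

Lemma energy_sym u v x : Omega x -> energy u v x = energy v u x.
Proof. by move=> Ox; rewrite /energy mxapp_sym// BT. Qed.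

Lemma energy_bounds v x : Omega x ->
  al * dot (grad Omega v x) (grad Omega v x) <= energy v v x <=
  be * dot (grad Omega v x) (grad Omega v x).
Proof.
by move=> Ox; have := Bell Ox (grad Omega v x); rewrite enorm_sqr dot_sym.
Qed.

Lemma energy_ge0 v x : Omega x -> 0 <= energy v v x.
Proof.
move=> Ox; have /andP[+ _] := energy_bounds v Ox; apply: le_trans.
by rewrite mulr_ge0 ?dot_ge0// ltW.
Qed.

Lemma coefficient_psd x : Omega x -> forall z, 0 <= dot (mxapp (B x) z) z.
Proof.
move=> Ox z; rewrite dot_sym; have /andP[+ _] := Bell Ox z; apply: le_trans.
by rewrite mulr_ge0 ?sqr_ge0// ltW.
Qed.

Lemma energy_Young u v x : Omega x ->
  `|energy u v x| <= (energy u u x + energy v v x) / 2.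
Proof. by move=> Ox; apply: mxapp_Young; [exact: BT|exact: coefficient_psd]. Qed.

Lemma measurable_energy u v : H1 Omega u -> H1 Omega v -> measurable_fun Omega (energy u v).
Proof.
move=> Hu Hv; rewrite /energy; under eq_fun do rewrite dot_mxappE.
apply: measurable_sum => i; apply: measurable_funM.
  apply: measurable_sum => j; apply: measurable_funM => //.
  by under eq_fun do rewrite mxE; have [[]] := wpartialP j Hu.
by under eq_fun do rewrite mxE; have [[]] := wpartialP i Hv.
Qed.

Lemma integrable_grad_sqr v : H1 Omega v ->
  lam.-integrable Omega (EFin \o (fun x => dot (grad Omega v x) (grad Omega v x))).
Proof.
move=> Hv; under eq_fun do rewrite dotE.
apply: integrable_sum_EFin => // i; under eq_fun do rewrite mxE.
by have [L _] := wpartialP i Hv; exact: L2_integrable_mul.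
Qed.

Lemma integrable_energy u v : H1 Omega u -> H1 Omega v ->
  lam.-integrable Omega (EFin \o energy u v).
Proof.
move=> Hu Hv.
have := integrableD mO (integrableZl mO (be / 2) (integrable_grad_sqr Hu))
  (integrableZl mO (be / 2) (integrable_grad_sqr Hv)).
apply: le_integrable => //; first by apply/measurable_EFinP; exact: measurable_energy.
move=> x Ox /=; rewrite lee_fin.
apply: le_trans (ler_norm _); apply: le_trans (energy_Young u v Ox) _.
have /andP[_ h1] := energy_bounds u Ox; have /andP[_ h2] := energy_bounds v Ox.
lra.
Qed.

Lemma energy_lin c u v w : H1 Omega u -> H1 Omega v ->
  {ae lam, forall x, Omega x -> energy (c *: u + v) w x = c * energy u w x + energy v w x}.
Proof.
move=> Hu Hv; apply: filterS (grad_lin c oO Hu Hv) => x H Ox.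
by rewrite /energy H// mxapp_lin dot_linl.
Qed.

(** The gradient is linear only almost everywhere, which integration does not see. *)
Lemma aform_semi_inner D : measurable D -> D `<=` Omega ->
  semi_inner (H1 Omega) (aform Omega B D).
Proof.
move=> mD DO; split.
- move=> c u v w Hu Hv Hw; have Huv : H1 Omega (c *: u + v) by exact: H1_lin.
  have I1 := integrableS mO mD DO (integrable_energy Hu Hw).
  have I2 := integrableS mO mD DO (integrable_energy Hv Hw).
  have I3 := integrableS mO mD DO (integrable_energy Huv Hw).
  rewrite /aform -RintegralZl// -RintegralD//; last exact: integrableZl_EFin.
  apply: ae_eq_Rintegral => //.
  + exact: integrable_measurable I3.
  + apply: measurable_funD; last exact: integrable_measurable I2.
    by apply: measurable_funM => //; exact: integrable_measurable I1.
  + by apply: filterS (energy_lin c w Hu Hv) => x H /DO; exact: H.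
- by move=> u v Hu Hv; apply: eq_Rintegral => x; rewrite inE => /DO Ox; exact: energy_sym.
- by move=> u Hu; apply: Rintegral_ge0 => x /DO; exact: energy_ge0.
Qed.

Lemma norm1E v : norm1 Omega v = nrm (aform Omega (fun=> 1%:M) Omega) v.
Proof.
rewrite /norm1 /nrm /aform; congr Num.sqrt; apply: eq_Rintegral => x _.
by rewrite mxapp1 enorm_sqr.
Qed.

Lemma normaE v : norma Omega B v = nrm (aform Omega B Omega) v.
Proof.
rewrite /norma /nrm /aform; congr Num.sqrt; apply: eq_Rintegral => x; rewrite inE => Ox.
by rewrite enorm_sqrtmx ?BT// => xi; rewrite dot_sym; exact: coefficient_psd.
Qed.

Lemma aform_ge v : H1 Omega v ->
  al * aform Omega (fun=> 1%:M) Omega v v <= aform Omega B Omega v v.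
Proof.
move=> Hv; have I := integrable_grad_sqr Hv.
rewrite /aform; under eq_Rintegral do rewrite mxapp1.
rewrite -RintegralZl//; apply: le_Rintegral => //.
- exact: integrableZl_EFin.
- exact: integrable_energy.
- by move=> x Ox; have /andP[] := energy_bounds v Ox.
Qed.

Lemma aform_le v : H1 Omega v ->
  aform Omega B Omega v v <= be * aform Omega (fun=> 1%:M) Omega v v.
Proof.
move=> Hv; have I := integrable_grad_sqr Hv.
rewrite /aform; under [X in _ <= _ * X]eq_Rintegral do rewrite mxapp1.
rewrite -RintegralZl//; apply: le_Rintegral => //.
- exact: integrable_energy.
- exact: integrableZl_EFin.
- by move=> x Ox; have /andP[] := energy_bounds v Ox.
Qed.

Lemma aform_patch D u v : D `<=` Omega ->
  aform Omega B D u v = \int[lam]_(x in Omega) (energy u v \_ D) x.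
Proof. by move=> DO; rewrite -Rintegral_mkcondr setIidr. Qed.

Lemma integrable_patch D u v : measurable D -> H1 Omega u -> H1 Omega v ->
  lam.-integrable Omega (EFin \o (energy u v \_ D)).
Proof.
move=> mD Hu Hv; have := integrable_energy Hu Hv; apply: le_integrable => //.
  apply/measurable_EFinP; apply/measurable_restrict => //.
  by apply: (measurable_funS mO _ (measurable_energy Hu Hv)) => x [].
by move=> x Ox /=; rewrite lee_fin patchE; case: ifP => // _; rewrite normr0.
Qed.

Lemma aform_elements_le N (T : 'I_N -> set 'rV[R]_d) v :
  (forall i, measurable (T i)) -> (forall i, T i `<=` Omega) ->
  (forall i j, i != j -> T i `&` T j = set0) -> H1 Omega v ->
  \sum_i aform Omega B (T i) v v <= aform Omega B Omega v v.
Proof.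
move=> mT TO Tdisj Hv; under eq_bigr do rewrite aform_patch//.
rewrite -Rintegral_sum//; last by move=> i; exact: integrable_patch.
apply: le_Rintegral => //.
- by apply: integrable_sum_EFin => // i; exact: integrable_patch.
- exact: integrable_energy.
move=> x Ox; have [[i Ti]|noT] := pselect (exists i, T i x).
  rewrite (bigD1 i)//= patchE mem_set// big1 ?addr0// => j ji.
  rewrite patchE memNset// => Tj; have : (T i `&` T j) x by [].
  by rewrite Tdisj// eq_sym.
rewrite big1 ?energy_ge0// => i _; rewrite patchE memNset// => Ti.
by apply: noT; exists i.
Qed.

(** At almost every point at most C of the gradients are nonzero, so that the
    square of their sum is at most C times the sum of their squares. The double sum
    of mixed terms is treated by Young's inequality. *)
Lemma aform_overlap N (Pt : 'I_N -> set 'rV[R]_d) (C : nat) (v : 'I_N -> 'rV[R]_d -> R) :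
  (forall i, H1 Omega (v i)) ->
  {ae lam, forall x, Omega x -> forall i, ~ Pt i x -> grad Omega (v i) x = 0} ->
  (forall x, Omega x -> (#|[pred i | `[< Pt i x >]]| <= C)%N) ->
  aform Omega B Omega (\sum_i v i) (\sum_i v i) <= C%:R * \sum_i aform Omega B Omega (v i) (v i).
Proof.
move=> Hv gv PC.
have H1W := H1_linsub mO.
have sa := aform_semi_inner mO (@subset_refl _ Omega).
have -> := si_sum2 H1W sa Hv.
have -> : \sum_i \sum_j aform Omega B Omega (v i) (v j) =
    \int[lam]_(x in Omega) \sum_i \sum_j energy (v i) (v j) x.
  rewrite Rintegral_sum//; last first.
    by move=> i; apply: integrable_sum_EFin => // j; exact: integrable_energy.
  apply: eq_bigr => i _; rewrite Rintegral_sum// => j; exact: integrable_energy.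
have -> : \sum_i aform Omega B Omega (v i) (v i) =
    \int[lam]_(x in Omega) \sum_i energy (v i) (v i) x.
  by rewrite Rintegral_sum// => i; exact: integrable_energy.
rewrite -RintegralZl//; last by apply: integrable_sum_EFin => // j; exact: integrable_energy.
apply: ae_le_Rintegral => //.
- by apply: integrable_sum_EFin => // i; apply: integrable_sum_EFin => // j; exact: integrable_energy.
- by apply: integrableZl_EFin => //; apply: integrable_sum_EFin => // j; exact: integrable_energy.
apply: filterS gv => x H Ox; move/(_ Ox) : H => H.
have e0 i : 0 <= energy (v i) (v i) x by exact: energy_ge0.
pose p i : R := `[< Pt i x >]%:R.
have p0 i : 0 <= p i by exact: ler0n.
have p1 i : p i <= 1 by rewrite /p; case: (`[< _ >]).
have eij i j : energy (v i) (v j) x <=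
    p i * p j * (energy (v i) (v i) x / 2) + p i * p j * (energy (v j) (v j) x / 2).
  rewrite -mulrDr -mulrDl; apply: le_trans (ler_norm _) _.
  have [Pi|Pi] := pselect (Pt i x); have [Pj|Pj] := pselect (Pt j x).
  - by rewrite /p !asboolT// !mul1r; exact: energy_Young.
  - rewrite {1}/energy (H j Pj) /dot trmx0 mulmx0 mxE normr0.
    by rewrite mulr_ge0// ?mulr_ge0// ?divr_ge0// addr_ge0.
  - rewrite {1}/energy (H i Pi) /mxapp mul0mx /dot mul0mx mxE normr0.
    by rewrite mulr_ge0// ?mulr_ge0// ?divr_ge0// addr_ge0.
  - rewrite {1}/energy (H i Pi) /mxapp mul0mx /dot mul0mx mxE normr0.
    by rewrite mulr_ge0// ?mulr_ge0// ?divr_ge0// addr_ge0.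
have pC : \sum_i p i <= C%:R.
  rewrite -natr_sum ler_nat; apply: leq_trans (PC _ Ox).
  rewrite -sum1_card [leqRHS]big_mkcond; apply: leq_sum => i _; rewrite unfold_in /=.
  by case: asboolP.
apply: (@le_trans _ _ (\sum_i \sum_j (p i * p j * (energy (v i) (v i) x / 2) +
    p i * p j * (energy (v j) (v j) x / 2)))).
  by apply: ler_sum => i _; apply: ler_sum.
under eq_bigr do rewrite big_split.
rewrite big_split /= [X in _ + X]exchange_big /= -big_split /= mulr_sumr.
apply: ler_sum => i _.
rewrite -!mulr_suml -mulr_sumr.
set S := \sum_i p i in pC *; set e := energy (v i) (v i) x.
have -> : p i * S * (e / 2) + S * p i * (e / 2) = (S * e) * p i by field.
have S0 : 0 <= S by exact: sumr_ge0.
apply: (@le_trans _ _ (S * e)); first by rewrite ler_piMr ?p1// mulr_ge0 ?(e0 i).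
by rewrite ler_wpM2r ?(e0 i).
Qed.

End forms.

(** * Patches of elements *)

Section patches.
Context {R : realType} {d : nat}.
Notation lam := (@lebn R d).
Variables (Omega : set 'rV[R]_d) (N : nat) (TH : 'I_N -> set 'rV[R]_d).
Hypotheses (oO : open Omega) (mTH : mesh Omega TH).

Lemma coarse_patch_open k i : open (coarse_patch TH k (TH i)).
Proof. by case: k => [|k] /=; [case: mTH => /(_ i) []|exact: open_interior]. Qed.

(** Elements are open and pairwise disjoint, so an element that meets the closure
    of a union of elements is one of them. *)
Lemma coarse_patch_elements k i j :
  TH j `<=` coarse_patch TH k (TH i) \/ TH j `&` coarse_patch TH k (TH i) = set0.
Proof.
have [oT _ dT _ _] := mTH; have {}oT l := (oT l).1.
case: k => [|k] /=.
  by have [->|ij] := eqVneq j i; [left|right; exact: dT].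
set I := (X in \bigcup_(_ in X) _).
have [Ij|Ij] := pselect (I j); [left|right].
  rewrite -open_subsetE//; apply: subset_trans (@subset_closure _ _).
  exact: bigcup_sup.
apply/seteqP; split => // x [Tx /interior_subset clx].
have /clx [y [[l Il Ty] Tjy]] : nbhs x (TH j) by exact: open_nbhs_nbhs.
have [jl|jl] := eqVneq j l; first by rewrite jl in Ij.
have : (TH j `&` TH l) y by [].
by rewrite dT.
Qed.

(** Test functions supported in W see neither u nor, therefore, its derivatives. *)
Lemma grad_ae0_of_eq0 (W : set 'rV[R]_d) u : open W -> W `<=` Omega -> H1 Omega u ->
  (forall x, W x -> u x = 0) -> {ae lam, forall x, W x -> grad Omega u x = 0}.
Proof.
move=> oW WO Hu u0; have mO := open_measurable_rV oO; have mW := open_measurable_rV oW.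
suff : {ae lam, forall x, forall i : 'I_d, W x -> wpartial Omega i u x = 0}.
  by apply: filterS => x H Wx; apply/rowP => i; rewrite !mxE H.
apply: filter_forall => i; have [Lg wg] := wpartialP i Hu.
apply: ae_eq0_of_test_fun => //; first exact: L2S Lg.
move=> phi tp; have tpO : test_fun Omega phi.
  by case: tp => ? ? sW; split => //; exact: subset_trans WO.
have := wg phi tpO.
rewrite (@eq_Rintegral _ _ _ _ _ (cst 0)) ?Rintegral_cst ?mul0r//; last first.
  move=> x _ /=; have [Wx|Wx] := pselect (W x); first by rewrite u0 ?mul0r.
  by rewrite (test_fun_out (test_fun_partial i tp) Wx) mulr0.
move=> /esym/eqP; rewrite oppr_eq0 => /eqP E0.
rewrite -(setIidr WO) Rintegral_mkcondr -[RHS]E0; apply: eq_Rintegral => x _.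
rewrite patchE; case: ifPn => //; rewrite notin_setE => Wx.
by rewrite (test_fun_out tp Wx) mulr0.
Qed.

(** Up to the null mesh skeleton, the complement of a patch is a union of elements,
    that is, an open set on which the function vanishes. *)
Lemma grad_ae0_off_patches k (v : 'I_N -> 'rV[R]_d -> R) :
  (forall i, H1 Omega (v i)) ->
  (forall i x, ~ coarse_patch TH k (TH i) x -> v i x = 0) ->
  {ae lam, forall x, Omega x -> forall i, ~ coarse_patch TH k (TH i) x ->
    grad Omega (v i) x = 0}.
Proof.
move=> Hv v0; have [oT TO dT _ skel] := mTH.
have mO := open_measurable_rV oO.
have H1ae : {ae lam, forall x, forall i j : 'I_N,
    TH j `&` coarse_patch TH k (TH i) = set0 -> TH j x -> grad Omega (v i) x = 0}.
  apply: filter_forall => i; apply: filter_forall => j.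
  have [D|D] := pselect (TH j `&` coarse_patch TH k (TH i) = set0); last first.
    by apply: nearW => x /D.
  have : {ae lam, forall x, TH j x -> grad Omega (v i) x = 0}.
    apply: grad_ae0_of_eq0 => //; first exact: (oT j).1.
    by move=> x Tx; apply: v0 => Px; have : (TH j `&` coarse_patch TH k (TH i)) x by []; rewrite D.
  by apply: filterS => x H _ Tx; exact: H.
have H2ae : {ae lam, forall x, Omega x -> exists j, TH j x}.
  exists (Omega `\` \bigcup_i TH i); split => //.
    apply: measurableD => //; apply: fin_bigcup_measurable => // j _.
    exact: open_measurable_rV (oT j).1.
  move=> x /= /not_implyP[Ox nT]; split => // -[j _ Tj]; apply: nT.
  by exists j.
move: H1ae H2ae; apply: filterS2 => x G1 G2 Ox i Px.
have [j Tj] := G2 Ox; apply: (G1 i j) => //.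
by case: (coarse_patch_elements k i j) => // /(_ x Tj).
Qed.

Lemma patch_count_le k x : Omega x ->
  (#|[pred i | `[< coarse_patch TH k (TH i) x >]]| <= overlap Omega TH k)%N.
Proof.
move=> Ox; set m := #|_|.
have mN : (m < N.+1)%N by rewrite ltnS -[X in (_ <= X)%N](card_ord N) max_card.
rewrite /overlap (bigD1 (Ordinal mN)) ?leq_maxl//.
by apply/asboolP; exists x.
Qed.

End patches.

(** * The abstract two-scale form *)

Section scalar.
Context {R : realType}.

Lemma CS2 (x y z t : R) : (x * y + z * t) ^+ 2 <= (x ^+ 2 + z ^+ 2) * (y ^+ 2 + t ^+ 2).
Proof.
rewrite -subr_ge0.
have -> : (x ^+ 2 + z ^+ 2) * (y ^+ 2 + t ^+ 2) - (x * y + z * t) ^+ 2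
 = (x * t - z * y) ^+ 2 by ring.
exact: sqr_ge0.
Qed.

(** The scalar core of the inf-sup estimate. The letters stand for W = a(w,w),
    r = a(r,r), n = a(v,v), p = a(w,v), q = a(r,v) and D = a(w - r, w - r), where v has
    unit H^1 seminorm, and X2 is the stabilized sum of the squared local errors. The
    component of w - r along v is controlled by p - q. For the orthogonal remainders,
    the sine of the angle between w and v is at most sqrt(1 - g^2/n) by near
    maximality of v, and the Cauchy-Schwarz inequality in the plane recombines the
    two components of r. Both bounds together cost the factor 1 + 2 = 3. *)
Lemma infsup_scalar (W r n p q g X2 al D : R) :
  0 < al -> al <= n -> 0 <= g -> g ^+ 2 <= al -> 0 <= W -> 0 <= X2 ->
  g ^+ 2 * W <= p ^+ 2 -> 0 <= W - p ^+ 2 / n -> 0 <= r - q ^+ 2 / n ->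
  n * r <= al * X2 ->
  D <= (p - q) ^+ 2 / n + (Num.sqrt (W - p ^+ 2 / n) + Num.sqrt (r - q ^+ 2 / n)) ^+ 2 ->
  g ^+ 2 * (D + X2) <= 3 * ((p - q) ^+ 2 + al * X2).
Proof.
move=> al0 aln g0 gal W0 X0 gW Wp rq nr HD.
have n0 : 0 < n by exact: lt_le_trans aln.
have n1 : n != 0 by rewrite gt_eqF.
set y := Num.sqrt _ in HD; set z := Num.sqrt _ in HD.
have y2 : y ^+ 2 = W - p ^+ 2 / n by rewrite sqr_sqrtr.
have z2 : z ^+ 2 = r - q ^+ 2 / n by rewrite sqr_sqrtr.
have y0 : 0 <= y by exact: sqrtr_ge0.
have z0 : 0 <= z by exact: sqrtr_ge0.
pose s := Num.sqrt n; have s0 : 0 < s by rewrite sqrtr_gt0.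
have s2 : s ^+ 2 = n by rewrite sqr_sqrtr// ltW.
(* Near maximality says that t2 bounds from below the squared cosine of the angle
   between w and v, hence c bounds the sine. *)
pose t2 := g ^+ 2 / n.
have t21 : t2 <= 1 by rewrite ler_pdivrMr// mul1r (le_trans gal).
pose t := g / s.
have t2E : t ^+ 2 = t2 by rewrite /t exprMn exprVn s2.
pose c := Num.sqrt (1 - t2); have c2 : c ^+ 2 = 1 - t2 by rewrite sqr_sqrtr// subr_ge0.
have c0 : 0 <= c by exact: sqrtr_ge0.
have gy : g * y <= c * `|p|.
  rewrite -(@ler_pXn2r _ 2)// ?nnegrE ?mulr_ge0// !exprMn y2 c2 real_normK ?num_real//.
  have H : g ^+ 2 * (W - p ^+ 2 / n) = g ^+ 2 * W - t2 * p ^+ 2 by rewrite /t2; field.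
  by rewrite H mulrBl mul1r lerD2r.
have gz : g * z = t * (s * z) by rewrite /t; field; rewrite gt_eqF.
have pq : `|p| <= `|p - q| + `|q| by rewrite -[X in `|X| <= _](subrK q p) ler_normD.
pose X := Num.sqrt (al * X2).
have X2E : X ^+ 2 = al * X2 by rewrite sqr_sqrtr// mulr_ge0// ltW.
have cq : c * `|q| + t * (s * z) <= X.
  rewrite -(@ler_pXn2r _ 2)// ?nnegrE ?sqrtr_ge0//; last first.
    by rewrite addr_ge0 ?mulr_ge0// ?invr_ge0// ltW.
  apply: le_trans (CS2 _ _ _ _) _; rewrite c2 t2E subrK mul1r X2E.
  rewrite exprMn s2 z2 real_normK ?num_real//.
  by rewrite mulrBr mulrCA divff// mulr1 addrC subrK.
have gyz : g * (y + z) <= `|p - q| + X.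
  have c1 : c <= 1.
    by rewrite -(@ler_pXn2r _ 2)// ?nnegrE// c2 expr1n gerBl -t2E sqr_ge0.
  have := normr_ge0 (p - q).
  have := ler_wpM2l c0 pq.
  rewrite [g * (y + z)]mulrDr gz; nra.
have gyz2 : (g * (y + z)) ^+ 2 <= 2 * ((p - q) ^+ 2 + al * X2).
  apply: (@le_trans _ _ ((`|p - q| + X) ^+ 2)).
    by rewrite ler_pXn2r// nnegrE ?mulr_ge0 ?addr_ge0// sqrtr_ge0.
  rewrite -X2E -[(p - q) ^+ 2]real_normK ?num_real//.
  have := sqr_ge0 (`|p - q| - X); rewrite !expr2; lra.
have gpq : g ^+ 2 * ((p - q) ^+ 2 / n) <= (p - q) ^+ 2.
  rewrite mulrCA ler_piMr// ?sqr_ge0//.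
have := ler_wpM2l (sqr_ge0 g) HD; rewrite mulrDr -exprMn => H.
have gX : g ^+ 2 * X2 <= al * X2 by rewrite ler_wpM2r.
rewrite mulrDr; lra.
Qed.

(** How a dual norm S is bounded from below: G is the value of the residual at a
    test vector whose squared norm G' does not exceed G. *)
Lemma le_sqr_of_le_mul_sqrt (S G G' : R) : 0 <= S -> 0 <= G -> G' <= G ->
  G <= S * Num.sqrt G' -> G <= S ^+ 2.
Proof.
move=> S0 G0 GG H.
have {}H : G <= S * Num.sqrt G.
  by apply: le_trans H _; rewrite ler_wpM2l// ler_wsqrtr.
have [/eqP ->|Gn] := boolP (G == 0); first exact: sqr_ge0.
have sG : 0 < Num.sqrt G by rewrite sqrtr_gt0 lt_def Gn.
have : Num.sqrt G <= S.
  by rewrite -(ler_pM2r sG) -expr2 sqr_sqrtr.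
move=> /(lerXn2r 2 (sqrtr_ge0 _)); rewrite sqr_sqrtr//; apply.
by rewrite nnegrE.
Qed.

Lemma sum_CS (I : finType) (x y : I -> R) :
  (forall i, 0 <= x i) -> (forall i, 0 <= y i) ->
  \sum_i Num.sqrt (x i) * Num.sqrt (y i) <=
    Num.sqrt (\sum_i x i) * Num.sqrt (\sum_i y i).
Proof.
move=> x0 y0.
suff [] : \sum_i Num.sqrt (x i) * Num.sqrt (y i) <=
    Num.sqrt (\sum_i x i) * Num.sqrt (\sum_i y i) /\
    0 <= \sum_i x i /\ 0 <= \sum_i y i by [].
apply: (big_rec3 (fun a b c => a <= Num.sqrt b * Num.sqrt c /\ 0 <= b /\ 0 <= c)).
  by rewrite sqrtr0 mul0r !lexx.
move=> i c b a _ [ab [b0 c0]]; rewrite !addr_ge0//; split=> //.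
apply: le_trans (lerD (lexx _) ab) _.
rewrite -[leRHS]sqrtrM ?addr_ge0//.
apply: le_trans (ler_norm _) _; rewrite -sqrtr_sqr ler_sqrt ?mulr_ge0 ?addr_ge0//.
by apply: le_trans (CS2 _ _ _ _) _; rewrite !sqr_sqrtr.
Qed.

End scalar.

Section two_scale_abstract.
Context {R : realType} {V : lmodType R}.
Variables (N : nat) (Vh VH : set V) (Vf : 'I_N -> set V).
Variables (a b : V -> V -> R) (aT : 'I_N -> V -> V -> R).
Variables (Q : 'I_N -> V -> V) (al be rho C : R).
Hypotheses (VhW : linsub Vh) (VHW : linsub VH) (VfW : forall i, linsub (Vf i)).
Hypotheses (VHh : VH `<=` Vh) (Vfh : forall i, Vf i `<=` Vh).
Hypotheses (sa : semi_inner Vh a) (sb : semi_inner Vh b)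
  (sT : forall i, semi_inner Vh (aT i)).
Hypotheses (al0 : 0 < al) (albe : al <= be).
Hypotheses (ab_ge : forall v, Vh v -> al * b v v <= a v v)
  (ab_le : forall v, Vh v -> a v v <= be * b v v).
Hypotheses (aT_le : forall v, Vh v -> \sum_i aT i v v <= a v v).
Hypotheses (VQ : forall i v, Vh v -> Vf i (Q i v))
  (aQ : forall i v w, Vh v -> Vf i w -> a (Q i v) w = aT i v w).
Hypotheses (C0 : 0 <= C) (rhoE : rho = C * (be / al)).
Hypothesis ovl : forall v : 'I_N -> V, (forall i, Vf i (v i)) ->
  a (\sum_i v i) (\sum_i v i) <= C * \sum_i a (v i) (v i).

Definition tsform (eH : V) (e : 'I_N -> V) vH (v : 'I_N -> V) :=
  a (eH - \sum_i e i) vH + Num.sqrt rho * \sum_i (a (e i) (v i) - aT i eH (v i)).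
Definition tsa2 eH (e : 'I_N -> V) :=
  a (eH - \sum_i e i) (eH - \sum_i e i) +
  rho * \sum_i a (Q i eH - e i) (Q i eH - e i).
Definition tsb2 vH (v : 'I_N -> V) := b vH vH + \sum_i b (v i) (v i).
Definition tse2 eH (e : 'I_N -> V) :=
  b eH eH + rho * \sum_i b (Q i eH - e i) (Q i eH - e i).

Let be0 : 0 < be. Proof. exact: lt_le_trans albe. Qed.
Let rho0 : 0 <= rho.
Proof. by rewrite rhoE mulr_ge0// divr_ge0// ltW. Qed.

Section fixed.
Variables (eH : V) (e : 'I_N -> V).
Hypotheses (HeH : VH eH) (He : forall i, Vf i (e i)).

Let r i := Q i eH - e i.
Let heH : Vh eH. Proof. exact: VHh. Qed.
Let he i : Vh (e i). Proof. exact: Vfh (He i). Qed.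
Let fr i : Vf i (r i). Proof. by apply: linsubB => //; exact: VQ. Qed.
Let hr i : Vh (r i). Proof. exact: Vfh (fr i). Qed.
Let hQ i : Vh (Q i eH). Proof. exact: Vfh (VQ _ heH). Qed.
Let hs : Vh (\sum_i e i). Proof. exact: linsub_sum. Qed.

Lemma tsformE vH v : (forall i, Vf i (v i)) ->
  tsform eH e vH v = a (eH - \sum_i e i) vH - Num.sqrt rho * \sum_i a (r i) (v i).
Proof.
move=> Hv; rewrite /tsform -mulrN -[- \sum_i a _ _]sumrN; congr (_ + _ * _).
apply: eq_bigr => i _; rewrite -aQ// (siBl VhW sa) ?opprB//; exact: Vfh (Hv i).
Qed.

Let b_le_a v : Vh v -> b v v <= a v v / al.
Proof. by move=> hv; rewrite ler_pdivlMr// mulrC ab_ge. Qed.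

(** By the corrector equations the fine part of the form only sees the local errors
    Q_i eH - e_i, so Cauchy-Schwarz applies term by term. *)
Lemma tsform_continuous vH v : VH vH -> (forall i, Vf i (v i)) ->
  tsform eH e vH v <= Num.sqrt be * Num.sqrt (tsa2 eH e) * Num.sqrt (tsb2 vH v).
Proof.
move=> HvH Hv; have hvH : Vh vH by exact: VHh.
have hv i : Vh (v i) by exact: Vfh (Hv i).
have nab w : Vh w -> nrm a w <= Num.sqrt be * nrm b w.
  move=> hw; rewrite /nrm -sqrtrM ?(ltW be0)// ler_wsqrtr// ab_le//.
have hd : Vh (eH - \sum_i e i) by exact: linsubB.
rewrite tsformE// -mulrN -[- \sum_i a _ _]sumrN.
have H1 : a (eH - \sum_i e i) vH <= Num.sqrt be * (nrm a (eH - \sum_i e i) * nrm b vH).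
  apply: le_trans (si_nrm VhW sa hd hvH) _; rewrite mulrCA ler_wpM2l ?sqrtr_ge0//.
  exact: nab.
have H2 : \sum_i - a (r i) (v i) <= Num.sqrt be *
   (Num.sqrt (\sum_i a (r i) (r i)) * Num.sqrt (\sum_i b (v i) (v i))).
  apply: le_trans (_ : _ <= \sum_i Num.sqrt be * (nrm a (r i) * nrm b (v i))) _.
    apply: ler_sum => i _.
    rewrite -mulN1r -(siZl VhW sa)//.
    apply: le_trans (si_nrm VhW sa _ _) _ => //; first exact: linsubZ.
    rewrite {1}/nrm (siZZ VhW sa)// sqrrN expr1n mul1r mulrCA ler_wpM2l ?sqrtr_ge0//.
    exact: nab.
  rewrite -mulr_sumr ler_wpM2l ?sqrtr_ge0// sum_CS// => i.
    exact: (si_ge0 sa).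
  exact: (si_ge0 sb).
apply: le_trans (lerD H1 (ler_wpM2l (sqrtr_ge0 rho) H2)) _.
rewrite [Num.sqrt rho * _]mulrCA -mulrDr -mulrA ler_wpM2l ?sqrtr_ge0//.
rewrite mulrA -[Num.sqrt rho * _]sqrtrM// -[leRHS]sqrtrM; last first.
  rewrite addr_ge0 ?(si_ge0 sa hd)// mulr_ge0// sumr_ge0// => i _.
  exact: (si_ge0 sa (hr i)).
- apply: le_trans (ler_norm _) _; rewrite -sqrtr_sqr ler_wsqrtr//.
  apply: le_trans (CS2 _ _ _ _) _; rewrite !sqr_sqrtr//.
  + by apply: sumr_ge0 => i _; exact: (si_ge0 sb).
  + exact: (si_ge0 sb).
  + by rewrite mulr_ge0// sumr_ge0// => i _; exact: (si_ge0 sa (hr i)).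
  + exact: (si_ge0 sa hd).
Qed.

(** With w = eH - sum_i Q_i eH and rs = sum_i (e_i - Q_i eH), the total error is
    w - rs. The test vector takes a multiple of the near maximizer v in the coarse
    slot and multiples of the local errors in the fine slots; the multiples make the
    value of the form bound the squared norm of the test vector. Finite overlap and
    the choice of rho make n * a(rs,rs) at most al * X2. *)
Lemma tsform_infsup (g S : R) : 0 <= g -> g ^+ 2 <= al -> 0 <= S ->
  (exists2 v, VH v & b v v = 1 /\
    g ^+ 2 * a (eH - \sum_i Q i eH) (eH - \sum_i Q i eH)
      <= a (eH - \sum_i Q i eH) v ^+ 2) ->
  (forall vH v, VH vH -> (forall i, Vf i (v i)) ->
    tsform eH e vH v <= S * Num.sqrt (tsb2 vH v)) ->
  g ^+ 2 * tsa2 eH e <= 3 * S ^+ 2.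
Proof.
move=> g0 gal S0 [v Hv [bv gv]] HS.
have hv : Vh v by exact: VHh.
set w := eH - \sum_i Q i eH in gv.
pose rs := \sum_i (- r i).
have hrs : Vh rs.
  by apply: linsub_sum => // i; rewrite -scaleN1r; apply: linsubZ.
have hw : Vh w by apply: linsubB => //; apply: linsub_sum.
have dE : eH - \sum_i e i = w - rs.
  rewrite /w /rs sumrN opprK /r big_split /= sumrN addrA addrNK//.
have n_ge : al <= a v v by rewrite -[al]mulr1 -bv ab_ge.
have n_le : a v v <= be by rewrite -[be]mulr1 -bv ab_le.
have n0 : 0 < a v v by exact: lt_le_trans n_ge.
pose X2 := rho * \sum_i a (r i) (r i).
have r0 i : 0 <= a (r i) (r i) by exact: (si_ge0 sa).
have X0 : 0 <= X2 by rewrite mulr_ge0// sumr_ge0.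
have rsX : a rs rs <= C * \sum_i a (r i) (r i).
  rewrite /rs sumrN -scaleN1r (siZZ VhW sa) ?sqrrN ?expr1n ?mul1r.
    exact: ovl.
  exact: linsub_sum.
have [H1 H2 H3] := siBB_proj VhW sa hw hrs hv n0.
have main : g ^+ 2 * tsa2 eH e <=
   3 * ((a w v - a rs v) ^+ 2 + al * X2).
  rewrite /tsa2 -/X2 dE.
  apply: (@infsup_scalar _ (a w w) (a rs rs) (a v v)) => //.
    exact: (si_ge0 sa).
  apply: (@le_trans _ _ (be * a rs rs)).
    by rewrite ler_wpM2r// (si_ge0 sa).
  apply: le_trans (ler_wpM2l (ltW be0) rsX) _.
  rewrite le_eqVlt; apply/orP; left; apply/eqP.
  by rewrite /X2 rhoE; field; rewrite gt_eqF.
apply: le_trans main _; rewrite ler_pM2l//.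
set c := a w v - a rs v.
have cE : c = a (eH - \sum_i e i) v by rewrite dE (siBl VhW sa).
pose k := - (al * Num.sqrt rho).
have sr : Num.sqrt rho ^+ 2 = rho by rewrite sqr_sqrtr.
apply: (@le_sqr_of_le_mul_sqrt _ S _ (tsb2 (c *: v) (fun i => k *: r i))) => //.
- by rewrite addr_ge0 ?sqr_ge0// mulr_ge0// ltW.
- rewrite /tsb2 (siZZ VhW sb)// bv mulr1 lerD2l.
  rewrite /X2 mulrA mulr_sumr ler_sum// => i _.
  rewrite (siZZ VhW sb)// /k sqrrN exprMn sr.
  apply: le_trans (ler_wpM2l _ (b_le_a (hr i))) _.
    by rewrite mulr_ge0// sqr_ge0.
  rewrite le_eqVlt; apply/orP; left; apply/eqP.
  by field; rewrite gt_eqF.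
- apply: le_trans (HS _ _ _ _); last first.
  + by move=> i; apply: linsubZ.
  + exact: linsubZ.
  rewrite tsformE; last by move=> i; apply: linsubZ.
  rewrite (siZr VhW sa)//; last exact: linsubB.
  rewrite -cE -expr2 lerD2l.
  rewrite (eq_bigr (fun i => k * a (r i) (r i))); last first.
    by move=> i _; rewrite (siZr VhW sa).
  rewrite -mulr_sumr /X2 /k mulNr mulrN opprK -{1}sr.
  rewrite le_eqVlt; apply/orP; left; apply/eqP; ring.
Qed.

(** Interpolation recovers the coarse part from the total error at the price of CI;
    the fine parts only pay the ellipticity constant. *)
Lemma tse2_le (CI : R) : 1 <= CI ->
  b eH eH <= CI ^+ 2 * b (eH - \sum_i e i) (eH - \sum_i e i) ->
  tse2 eH e <= CI ^+ 2 / al * tsa2 eH e.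
Proof.
move=> CI1 H.
have hd : Vh (eH - \sum_i e i) by exact: linsubB.
have CI2 : 1 <= CI ^+ 2 by rewrite exprn_ege1.
rewrite /tse2 /tsa2 mulrDr lerD//.
  apply: le_trans H _; rewrite -mulrA [al^-1 * _]mulrC ler_wpM2l ?sqr_ge0// b_le_a//.
rewrite mulrCA ler_wpM2l// mulr_sumr ler_sum// => i _.
rewrite -mulrA [al^-1 * _]mulrC; apply: le_trans (b_le_a _) _ => //; first exact: hr.
by rewrite ler_peMl// divr_ge0 ?(ltW al0)// (si_ge0 sa (hr i)).
Qed.

(** Split the total error into eH, the sum of its correctors and the sum of the
    local errors. Each corrector is an energy projection, so its energy is at most
    the energy of eH on the element, and finite overlap handles both sums. The
    alternative on C, a number of patches, is used to absorb one more rho into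
    3 * (C + 1) * rho. *)
Lemma tsa2_le : (C = 0 \/ 1 <= C) ->
  tsa2 eH e <= 3 * (C + 1) * be * tse2 eH e.
Proof.
move=> C01.
have hQs : Vh (\sum_i Q i eH) by exact: linsub_sum.
have hrN i : Vh (- r i) by rewrite -scaleN1r; apply: linsubZ.
have hrs : Vh (\sum_i (- r i)) by exact: linsub_sum.
have dE : eH - \sum_i e i = eH - \sum_i Q i eH - \sum_i (- r i).
  rewrite sumrN opprK /r big_split /= sumrN addrA addrNK//.
have Hd := siB3 VhW sa heH hQs hrs.
have HQ : a (\sum_i Q i eH) (\sum_i Q i eH) <= C * a eH eH.
  apply: le_trans (ovl (fun i => VQ i heH)) _.
  rewrite ler_wpM2l//; apply: le_trans (aT_le heH); apply: ler_sum => i _.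
  have aQQ : a (Q i eH) (Q i eH) = aT i eH (Q i eH) by rewrite aQ//; exact: VQ.
  have QT : aT i (Q i eH) (Q i eH) <= a (Q i eH) (Q i eH).
    apply: le_trans (aT_le (hQ i)); rewrite (bigD1 i)//= lerDl sumr_ge0// => j _.
    exact: (si_ge0 (sT j)).
  have := si_ge0 (sT i) (linsubB VhW heH (hQ i)).
  rewrite (siBB VhW (sT i))// -aQQ; lra.
have Hr : a (\sum_i (- r i)) (\sum_i (- r i)) <= C * \sum_i a (r i) (r i).
  rewrite sumrN -scaleN1r (siZZ VhW sa) ?sqrrN ?expr1n ?mul1r; first exact: ovl.
  exact: linsub_sum.
have beH := ab_le heH.
have ber : \sum_i a (r i) (r i) <= be * \sum_i b (r i) (r i).
  by rewrite mulr_sumr ler_sum// => i _; exact: ab_le.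
rewrite /tsa2 /tse2 dE -/(r _).
set A := a _ _ in Hd *; set x := a eH eH in HQ beH Hd; set q := a (\sum_i Q i eH) _ in HQ Hd.
set s := a (\sum_i - r i) _ in Hr Hd; set Y := \sum_i a _ _ in Hr ber *.
set Z := \sum_i b _ _ in ber *; set X := b eH eH in beH *.
have Z0 : 0 <= Z by rewrite sumr_ge0// => i _; exact: (si_ge0 sb).
have Y0 : 0 <= Y by rewrite sumr_ge0// => i _; exact: (si_ge0 sa).
have Crho : C <= rho.
  by rewrite rhoE ler_peMr// ler_pdivlMr// mul1r.
have HY : 3 * (C * Y) + rho * Y <= 3 * (C + 1) * (rho * Y).
  have CY : C * Y <= rho * Y by rewrite ler_wpM2r.
  have rY : 0 <= rho * Y by rewrite mulr_ge0.
  case: C01 => [c0|c1]; first by rewrite c0 in CY *; lra.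
  have : rho * Y <= C * (rho * Y) by rewrite ler_peMl.
  lra.
apply: (@le_trans _ _ (3 * (C + 1) * x + 3 * (C + 1) * (rho * Y))); first by lra.
rewrite -mulrDr -[leRHS]mulrA; apply: ler_wpM2l.
  by rewrite mulr_ge0// addr_ge0.
by rewrite mulrDr lerD// mulrCA ler_wpM2l.
Qed.

End fixed.

End two_scale_abstract.

Section corrector_kernel.
Context {R : realType} {V : lmodType R}.
Variables (N : nat) (Vh : set V) (Vf : 'I_N -> set V).
Variables (a b : V -> V -> R) (aT : 'I_N -> V -> V -> R) (Q : 'I_N -> V -> V) (al : R).
Hypotheses (VhW : linsub Vh) (VfW : forall i, linsub (Vf i)).
Hypotheses (Vfh : forall i, Vf i `<=` Vh).
Hypotheses (sa : semi_inner Vh a) (sb : semi_inner Vh b)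
  (sT : forall i, semi_inner Vh (aT i)).
Hypotheses (al0 : 0 < al) (ab_ge : forall v, Vh v -> al * b v v <= a v v).
Hypotheses (VQ : forall i v, Vh v -> Vf i (Q i v))
  (aQ : forall i v w, Vh v -> Vf i w -> a (Q i v) w = aT i v w).

Let hQ i v : Vh v -> Vh (Q i v). Proof. by move=> hv; exact: Vfh (VQ _ hv). Qed.

(** The correctors of zero need not be zero, but their energy is. *)
Lemma corrector_sum0_ker : a (0 - \sum_i Q i 0) (0 - \sum_i Q i 0) = 0.
Proof.
have h0 : Vh 0 by case: VhW.
have Q0 i : a (Q i 0) (Q i 0) = 0.
  by rewrite aQ ?(si0l VhW (sT i))//; [exact: hQ|exact: VQ].
have hs : Vh (\sum_i Q i 0) by apply: linsub_sum => // i; exact: hQ.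
rewrite (siBB VhW sa)// !(si0l VhW sa)// (si_sum2 VhW sa) => [|i]; last exact: hQ.
rewrite big1 ?mulr0 ?subr0 ?addr0// => i _; rewrite big1// => j _.
by apply: (si_ker VhW sa) => //; exact: hQ.
Qed.

(** The corrector problems determine the correctors up to the kernel of the energy
    seminorm, which is all that the error norms can see. *)
Lemma corrector_sub_ker i u v y : Vh u -> Vh v -> Vf i y ->
  b (Q i (u - v) - (Q i u - y)) (Q i (u - v) - (Q i u - y)) =
  b (Q i v - y) (Q i v - y).
Proof.
move=> hu hv fy; have huv : Vh (u - v) by exact: linsubB.
pose z := Q i (u - v) - (Q i u - Q i v).
have fz : Vf i z by apply: linsubB => //; [exact: VQ|apply: linsubB => //; exact: VQ].
have hz := Vfh fz.
have z0 : b z z = 0.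
  have az : a z z = 0.
    rewrite {1}/z !(siBl VhW sa)//; try exact: hQ; last by apply: linsubB => //; exact: hQ.
    by rewrite !aQ// (siBl VhW (sT i))// subrr.
  apply/eqP; rewrite eq_le (si_ge0 sb)// andbT.
  by have := ab_ge hz; rewrite az pmulr_rle0.
have hy : Vh (Q i v - y) by apply: linsubB => //; [exact: hQ|exact: Vfh fy].
have -> : Q i (u - v) - (Q i u - y) = z - (Q i v - y).
  by rewrite /z !opprB -addrA; congr (_ + _); rewrite [RHS]addrC addrA subrK.
by rewrite (siNN VhW sb)// (siBB_ker VhW sb).
Qed.

End corrector_kernel.

Section sup_inf.
Context {R : realType}.

(** A positive infimum or supremum of real sets is a genuine one, as both default to
    zero on unbounded or empty sets. *)
Lemma infsup_gt (I J : Type) (A : set I) (B : set J) (q : I -> J -> R) (g : R) :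
  0 <= g -> g < inf [set sup [set q w v | v in B] | w in A] ->
  forall w, A w -> exists2 v, B v & g < q w v.
Proof.
move=> g0 gi w Aw.
have hi : has_inf [set sup [set q w v | v in B] | w in A].
  by apply: contrapT => /inf_out i0; move: gi; rewrite i0 ltNge g0.
have gs : g < sup [set q w v | v in B].
  by apply: lt_le_trans gi _; apply: ge_inf; [case: hi|exists w].
have hs : has_sup [set q w v | v in B].
  by apply: contrapT => /sup_out i0; move: gs; rewrite i0 ltNge g0.
have [|_ [v Bv <-]] := @sup_adherent _ _ (sup [set q w v | v in B] - g) _ hs.
  by rewrite subr_gt0.
by rewrite opprB addrC subrK => H; exists v.
Qed.

End sup_inf.

Section spaces.
Context {R : realType} {d : nat}.
Implicit Types (u v : 'rV[R]_d -> R).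

Lemma P1_linsub (Omega : set 'rV[R]_d) N (TH : 'I_N -> set 'rV[R]_d) :
  linsub (P1 Omega TH).
Proof.
split.
  split; first by move=> x; exact: cvg_cst.
  by move=> i; exists 0, 0 => x _; rewrite /dot mul0mx mxE addr0.
move=> c u v [cu Hu] [cv Hv]; split.
  by move=> x; apply: cvgD; [apply: cvgZl_tmp; exact: cu|exact: cv].
move=> i; have [a [s Ha]] := Hu i; have [b [t Hb]] := Hv i.
exists (c *: a + b), (c * s + t) => x Tx.
by rewrite !fctE /= Ha// Hb// dot_linl /GRing.scale /=; ring.
Qed.

End spaces.

(** * Error bounds for the two-scale solution *)

Theorem theorem4p7 (R : realType) (p d : nat)
  (P : set 'rV[R]_p) (Omega : set 'rV[R]_d)
  (hOmega : bounded_lipschitz_domain Omega)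
  (f : 'rV[R]_d -> R) (hf : L2 Omega f)
  (alpha beta : R) (halpha : 0 < alpha) (hbeta : alpha <= beta)
  (A : 'rV[R]_p -> 'rV[R]_d -> 'M[R]_d)
  (hA : elliptic_coeff P Omega alpha beta A)
  (n : nat) (Th : 'I_n -> set 'rV[R]_d) (theta : R)
  (hTh : mesh Omega Th) (hreg : shape_regular theta Th)
  (S : 'I_n -> set ('rV[R]_d -> R)) (Vh : set ('rV[R]_d -> R))
  (hVh : conforming_fe_space Omega Th S Vh)
  (N : nat) (TH : 'I_N -> set 'rV[R]_d)
  (hTH : mesh Omega TH) (halign : aligned TH Th)
  (VH : set ('rV[R]_d -> R)) (hVH : VH = coarse_space Omega TH Vh)
  (hVH0 : exists2 v, VH v & v != 0)
  (k : nat) (CI : R) (IH : ('rV[R]_d -> R) -> 'rV[R]_d -> R)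
  (hIH : interpolation Omega Vh VH CI IH)
  (Vf : 'I_N -> set ('rV[R]_d -> R))
  (hVf : Vf = fine_space_loc TH k Vh IH)
  (mu : 'rV[R]_p) (hmu : P mu)
  (Q : 'I_N -> ('rV[R]_d -> R) -> 'rV[R]_d -> R)
  (hQ : correctors Omega (A mu) TH Vh Vf Q)
  (gamma : R) (hgamma : gamma = infsup Omega (A mu) VH (corrector_sum Q))
  (hgamma0 : 0 < gamma) (hgamma1 : gamma <= Num.sqrt alpha)
  (uHk : 'rV[R]_d -> R)
  (huHk : pg_lod_solution Omega (A mu) f VH (corrector_sum Q) uHk)
  (Covl : nat) (hCovl : Covl = overlap Omega TH k)
  (kappa rho : R) (hkappa : kappa = beta / alpha) (hrho : rho = Covl%:R * kappa)
  (VV : set (('rV[R]_d -> R) * ('I_N -> 'rV[R]_d -> R)))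
  (hVV : VV = two_scale_space VH Vf)
  (umu : ('rV[R]_d -> R) * ('I_N -> 'rV[R]_d -> R))
  (humu : umu = (uHk, fun i => Q i uHk))
  (uH : 'rV[R]_d -> R) (uf : 'I_N -> 'rV[R]_d -> R) (hu : VV (uH, uf)) :
  let eta_a_u := eta_a Omega (A mu) TH f rho VV gamma (uH, uf) in
  let eta_1_u := eta_1 Omega (A mu) TH f rho VV gamma CI alpha (uH, uf) in
  let err_a := ts_norma Omega (A mu) rho Q (umu - (uH, uf)) in
  let err_1 := Num.sqrt (norm1 Omega (uHk - uH) ^+ 2 +
                 rho * \sum_(i < N) norm1 Omega (Q i uH - uf i) ^+ 2) in
  [/\ err_a <= eta_a_u,
      eta_a_u <= Num.sqrt 5 * gamma^-1 * Num.sqrt beta * err_a,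
      err_1 <= eta_1_u
    & eta_1_u <= Num.sqrt 15 * CI * Num.sqrt (Covl%:R + 1) * Num.sqrt kappa *
                 gamma^-1 * Num.sqrt beta * err_1].
Proof.
move=> eta_a_u eta_1_u err_a err_1.
have oO : open Omega by case: hOmega.
have mO := open_measurable_rV oO.
have [mB _ BT Bell] := hA mu hmu.
pose a := aform Omega (A mu) Omega.
pose b := aform Omega (fun=> 1%:M) Omega.
pose aT i := aform Omega (A mu) (TH i).
have beta0 : 0 < beta by exact: lt_le_trans hbeta.
have [Vh_sub _ VhH10 _ _] := hVh.
have VhW : linsub Vh by [].
have VhH1 v : Vh v -> H1 Omega v by move=> /VhH10 [[]].
have [oT TO dT _ _] := hTH.
have mT i : measurable (TH i) by exact: open_measurable_rV (oT i).1.
have siW (W1 W2 : set ('rV[R]_d -> R)) F : W1 `<=` W2 -> semi_inner W2 F -> semi_inner W1 F.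
  move=> W12 [s1 s2 s3]; split.
  - by move=> c u v w Hu Hv Hw; apply: s1; exact: W12.
  - by move=> u v Hu Hv; apply: s2; exact: W12.
  - by move=> u Hu; apply: s3; exact: W12.
have sa : semi_inner Vh a.
  by apply: siW VhH1 _; exact: (aform_semi_inner oO halpha mB BT Bell).
have sb : semi_inner Vh b.
  apply: siW VhH1 _.
  apply: (@aform_semi_inner _ _ Omega (fun=> 1%:M) 1 1) => //.
  - by move=> x _; rewrite trmx1.
  - by move=> x _ xi; rewrite mxapp1 mul1r enorm_sqr lexx.
have sT i : semi_inner Vh (aT i).
  by apply: siW VhH1 _; exact: (aform_semi_inner oO halpha mB BT Bell).
have ab_ge v : Vh v -> alpha * b v v <= a v v.
  by move=> /VhH1 Hv; exact: (aform_ge oO halpha mB BT Bell Hv).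
have ab_le v : Vh v -> a v v <= beta * b v v.
  by move=> /VhH1 Hv; exact: (aform_le oO halpha mB BT Bell Hv).
have n1 v : norm1 Omega v = nrm b v by exact: norm1E.
have na v : norma Omega (A mu) v = nrm a v by exact: (normaE halpha BT Bell).
have aT_le v : Vh v -> \sum_i aT i v v <= a v v.
  by move=> /VhH1 Hv; exact: (aform_elements_le oO halpha mB BT Bell mT TO dT Hv).
have VHh : VH `<=` Vh by rewrite hVH => v [].
have VHW : linsub VH.
  have [P10 P1l] := P1_linsub Omega TH; have [V0 Vl] := VhW.
  rewrite hVH; split; first by split.
  by move=> c u v [Vu Pu] [Vv Pv]; split; [exact: Vl|exact: P1l].
have [IHV IHl IHid IHn] := hIH.
have Vfh i : Vf i `<=` Vh by rewrite hVf => v [[]].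
have VQ i v : Vh v -> Vf i (Q i v) by move=> hv; have [] := hQ i v hv.
have aQ i v w : Vh v -> Vf i w -> a (Q i v) w = aT i v w.
  by move=> hv fw; have [_ H] := hQ i v hv; exact: H.
have h0 : Vh 0 by case: VhW.
have Vf_lin i c u v : Vf i u -> Vf i v -> Vf i (c *: u + v).
  rewrite hVf => -[[Vu Iu] Hu] [[Vv Iv] Hv]; split; first split.
  - by case: VhW => _; apply.
  - by rewrite IHl// Iu Iv scaler0 addr0.
  - by apply: H10ext_lin => //; exact: coarse_patch_open hTH _ _.
have VfW i : linsub (Vf i).
  split; last exact: Vf_lin.
  rewrite -(addNr (Q i 0)) -scaleN1r; apply: Vf_lin; exact: VQ.
have ovl (v : 'I_N -> 'rV[R]_d -> R) : (forall i, Vf i (v i)) ->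
    a (\sum_i v i) (\sum_i v i) <= Covl%:R * \sum_i a (v i) (v i).
  move=> fv; have Hv i : H1 Omega (v i) by apply: VhH1; exact: Vfh (fv i).
  apply: (aform_overlap oO halpha mB BT Bell Hv
    (Pt := fun i => coarse_patch TH k (TH i))).
    apply: (grad_ae0_off_patches oO hTH Hv) => i x Px.
    by have := fv i; rewrite hVf => -[_ [_]]; apply.
  by move=> x Ox; rewrite hCovl; exact: patch_count_le.
have C0 : 0 <= Covl%:R :> R by exact: ler0n.
have aE : aform Omega (A mu) Omega = a by [].
have aTE i : aform Omega (A mu) (TH i) = aT i by [].
clearbody a b aT.
have rhoE : rho = Covl%:R * (beta / alpha) by rewrite hrho hkappa.
have rho0 : 0 <= rho by rewrite rhoE mulr_ge0// divr_ge0// ltW.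
(* The supremum need not be attained, whence g < gamma. The value of the quotient is
   positive for w != 0, which excludes the zero seminorms hidden in a division by
   zero; for w = 0 the energy of w - sum_i Q_i w vanishes and any unit v will do. *)
have infsupP g w : 0 <= g -> g < gamma -> VH w ->
    exists2 v, VH v & b v v = 1 /\
      g ^+ 2 * a (w - \sum_i Q i w) (w - \sum_i Q i w) <= a (w - \sum_i Q i w) v ^+ 2.
  move=> g0 gg Hw.
  have ne0 z : VH z -> z != 0 -> exists2 v, VH v & b v v = 1 /\
      g ^+ 2 * a (z - \sum_i Q i z) (z - \sum_i Q i z) <= a (z - \sum_i Q i z) v ^+ 2.
    move=> Hz z0.
    have hz : Vh (z - \sum_i Q i z).
      apply: linsubB => //; first exact: VHh.
      by apply: linsub_sum => // i; apply: Vfh (VQ _ _ _); exact: VHh.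
    rewrite hgamma /infsup in gg.
    have [|v [Hv _]] := @infsup_gt _ _ _ _ _ _ _ g0 gg z; first by split=> //; exact/eqP.
    rewrite /corrector_sum na n1 aE.
    set W := z - _ in hz *; move=> gq.
    have hv := VHh _ Hv.
    have bv0 : 0 < nrm b v.
      rewrite lt_def nrm_ge0 andbT; apply/eqP => v0.
      by move: gq; rewrite v0 mulr0 invr0 mulr0 ltNge g0.
    have aW0 : 0 < nrm a W.
      rewrite lt_def nrm_ge0 andbT; apply/eqP => v0.
      by move: gq; rewrite v0 mul0r invr0 mulr0 ltNge g0.
    exists ((nrm b v)^-1 *: v); first exact: linsubZ.
    split.
      by rewrite (siZZ VhW sb)// -(nrm_sqr sb hv) -exprMn mulVf ?expr1n// gt_eqF.
    rewrite (siZr VhW sa)// -(nrm_sqr sa hz) -exprMn.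
    have gW : g * nrm a W <= (nrm b v)^-1 * a W v.
      by rewrite [leRHS]mulrC ler_pdivlMr// -mulrA; move/ltW: gq; rewrite ler_pdivlMr ?mulr_gt0.
    have gW0 : 0 <= g * nrm a W by rewrite mulr_ge0// ltW.
    by rewrite ler_pXn2r// nnegrE// (le_trans gW0).
  have [->|w0] := eqVneq w 0; last exact: ne0.
  have [z Hz z0] := hVH0; have [v Hv [bv _]] := ne0 z Hz z0.
  exists v => //; split=> //.
  by rewrite (corrector_sum0_ker VhW Vfh sa sT VQ aQ) mulr0 sqr_ge0.
have [HuH Huf] : VH uH /\ forall i, Vf i (uf i) by move: hu; rewrite hVV.
have [HuHk FuHk] := huHk.
have huH := VHh _ HuH; have huHk' := VHh _ HuHk.
pose eH := uHk - uH; pose e i := Q i uHk - uf i.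
have HeH : VH eH by exact: linsubB.
have He i : Vf i (e i) by apply: linsubB => //; exact: VQ.
have heH := VHh _ HeH; have he i : Vh (e i) by exact: Vfh (He i).
have hQH i : Vh (Q i uHk) by exact: Vfh (VQ i _ huHk').
have hd : Vh (eH - \sum_i e i) by apply: linsubB => //; exact: linsub_sum.
have dE : eH - \sum_i e i = (uHk - \sum_i Q i uHk) - (uH - \sum_i uf i).
  by rewrite /eH /e sumrB !opprB [X in _ + X = _]addrC addrACA [- uH + _]addrC.
(* Galerkin orthogonality: the load is the form at the solution, whose fine part
   vanishes by the corrector equations. *)
have resE v1 v2 : VH v1 -> (forall i, Vf i (v2 i)) ->
    Fform Omega f v1 - Bform Omega (A mu) TH rho (uH, uf) (v1, v2) =
    tsform a aT rho eH e v1 v2.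
  move=> Hv1 Hv2; have hv1 := VHh _ Hv1; have hv2 i := Vfh _ _ (Hv2 i).
  have huf i : Vh (uf i) by exact: Vfh (Huf i).
  have hs : Vh (uHk - \sum_i Q i uHk) by apply: linsubB => //; exact: linsub_sum.
  have hs' : Vh (uH - \sum_i uf i) by apply: linsubB => //; exact: linsub_sum.
  rewrite /Bform /tsform /= -(FuHk _ Hv1) /corrector_sum !aE dE (siBl VhW sa hs hs' hv1) opprD addrA.
  congr (_ + _); rewrite -mulrN -sumrN; congr (_ * _); apply: eq_bigr => i _.
  rewrite (siBl VhW sa)// (siBl VhW (sT i))// aQ// aTE; ring.
have tsb2E v1 v2 : VH v1 -> (forall i, Vf i (v2 i)) ->
    ts_norm1 Omega (v1, v2) = Num.sqrt (tsb2 b v1 v2).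
  move=> Hv1 Hv2; rewrite /ts_norm1 /tsb2 /= n1 (nrm_sqr sb (VHh _ Hv1)); congr (Num.sqrt (_ + _)).
  by apply: eq_bigr => i _; rewrite n1 (nrm_sqr sb (Vfh _ _ (Hv2 i))).
pose E2 := tsa2 a Q rho eH e.
pose r := residual Omega (A mu) TH f rho VV (uH, uf).
have cont v1 v2 (Hv1 : VH v1) (Hv2 : forall i, Vf i (v2 i)) :=
  tsform_continuous VhW VfW VHh Vfh sa sb halpha hbeta ab_le VQ aQ C0 rhoE HeH He Hv1 Hv2.
pose RS := [set (Fform Omega f vv.1 - Bform Omega (A mu) TH rho (uH, uf) vv) /
  ts_norm1 Omega vv | vv in VV `\ 0].
(* Boundedness of the form makes the supremum in the residual genuine. *)
have RS_ub x : RS x -> x <= Num.sqrt beta * Num.sqrt E2.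
  move=> [[v1 v2] [+ _] <-]; rewrite hVV => -[/= Hv1 Hv2].
  rewrite resE// tsb2E//.
  have [->|t0] := eqVneq (Num.sqrt (tsb2 b v1 v2)) 0.
    by rewrite invr0 mulr0 mulr_ge0// sqrtr_ge0.
  by rewrite ler_pdivrMr ?lt_def ?t0 ?sqrtr_ge0//; exact: cont.
have RS_le x : RS x -> x <= r.
  move=> RSx; apply: ub_le_sup => //.
  by exists (Num.sqrt beta * Num.sqrt E2) => y; exact: RS_ub.
have RS0 : RS !=set0.
  have [z Hz z0] := hVH0.
  exists ((Fform Omega f z - Bform Omega (A mu) TH rho (uH, uf) (z, fun i => Q i 0)) /
    ts_norm1 Omega (z, fun i => Q i 0)); exists (z, fun i => Q i 0) => //.
  split; first by rewrite hVV; split=> //= i; exact: VQ.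
  by move=> [z1]; move: z0; rewrite z1 eqxx.
have r_le : r <= Num.sqrt beta * Num.sqrt E2 by apply: ge_sup.
have tsform_le v1 v2 : VH v1 -> (forall i, Vf i (v2 i)) ->
    tsform a aT rho eH e v1 v2 <= r * Num.sqrt (tsb2 b v1 v2).
  move=> Hv1 Hv2; have [t0|t0] := eqVneq (Num.sqrt (tsb2 b v1 v2)) 0.
    by have := cont _ _ Hv1 Hv2; rewrite t0 !mulr0.
  rewrite -ler_pdivrMr ?lt_def ?t0 ?sqrtr_ge0// -resE// -tsb2E//; apply: RS_le.
  exists (v1, v2) => //; split; first by rewrite hVV.
  move=> [v10 v20]; move: t0; rewrite v10 v20 /tsb2 (si0l VhW sb)// add0r big1 ?sqrtr0 ?eqxx//.
have [v0 Hv0 [bv0 _]] := infsupP 0 eH (lexx 0) hgamma0 HeH.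
have hv0 := VHh _ Hv0.
have r0 : 0 <= r.
  have T0 v : VH v -> tsform a aT rho eH e v (fun=> 0) = a (eH - \sum_i e i) v.
    move=> Hv; rewrite (tsformE rho VhW VHh Vfh sa VQ aQ HeH He) => [|i]; last by case: (VfW i).
    rewrite [\sum_i a _ 0]big1 ?mulr0 ?subr0// => i _; rewrite (siC sa) ?(si0l VhW sa)//.
      by apply: linsubB => //; exact: Vfh (VQ _ _ _).
    by apply: linsubB => //; exact: Vfh (VQ _ _ _).
  have tb v : b v v = 1 -> Num.sqrt (tsb2 b v (fun=> 0 : 'rV[R]_d -> R)) = 1.
    move=> bv; rewrite /tsb2 bv big1 ?addr0 ?sqrtr1// => i _; exact: (si0l VhW sb).
  have f0 i : Vf i 0 by case: (VfW i).
  have HNv0 : VH ((-1) *: v0) by exact: linsubZ.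
  have bNv0 : b ((-1) *: v0) ((-1) *: v0) = 1.
    by rewrite (siZZ VhW sb)// sqrrN expr1n mul1r.
  have := tsform_le _ _ Hv0 f0; rewrite T0// tb// mulr1 => h1.
  have := tsform_le _ _ HNv0 f0; rewrite T0// tb// mulr1 (siZr VhW sa)// => h2.
  lra.
have E20 : 0 <= E2.
  rewrite addr_ge0 ?(si_ge0 sa)// mulr_ge0// sumr_ge0// => i _; apply: (si_ge0 sa).
  by apply: linsubB => //; exact: Vfh (VQ _ _ heH).
have g2al : gamma ^+ 2 <= alpha.
  by rewrite -(sqr_sqrtr (ltW halpha)) lerXn2r// ?nnegrE ?sqrtr_ge0// ltW.
(* The inf-sup estimate costs the factor 3 for every g < gamma, and the choice
   g^2 = 3/5 gamma^2 turns it into 5 for gamma itself. *)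
have E2_le : E2 <= 5 * gamma ^- 2 * r ^+ 2.
  pose g := gamma * Num.sqrt (3 / 5).
  have s35 : Num.sqrt (3 / 5) ^+ 2 = 3 / 5 :> R by rewrite sqr_sqrtr.
  have s351 : Num.sqrt (3 / 5) < 1 :> R.
    by rewrite -[X in _ < X]sqrtr1 ltr_sqrt//; lra.
  have g0 : 0 <= g by rewrite mulr_ge0 ?sqrtr_ge0// ltW.
  have gg : g < gamma by rewrite /g gtr_pMr.
  have g2 : g ^+ 2 = gamma ^+ 2 * (3 / 5) by rewrite exprMn s35.
  have := tsform_infsup VhW VHW VfW VHh Vfh sa sb halpha hbeta ab_ge ab_le VQ aQ C0 rhoE ovl
    HeH He (S := r) g0 _ r0 (infsupP g eH g0 gg HeH) tsform_le.
  have ga : g ^+ 2 <= alpha.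
    by rewrite g2 (le_trans _ g2al)// ler_piMr ?sqr_ge0//; lra.
  move=> /(_ ga); rewrite -/E2 g2 => H.
  rewrite mulrAC ler_pdivlMr ?exprn_gt0//; lra.
have err_aE : err_a = Num.sqrt E2.
  rewrite /err_a humu /ts_norma /= /E2 /tsa2 na (nrm_sqr sa hd); congr (Num.sqrt (_ + _ * _)).
  apply: eq_bigr => i _; rewrite na (nrm_sqr sa)//.
  by apply: linsubB => //; exact: Vfh (VQ _ _ heH).
have err_1E : err_1 = Num.sqrt (tse2 b Q rho eH e).
  rewrite /err_1 /tse2 n1 (nrm_sqr sb heH); congr (Num.sqrt (_ + _ * _)).
  apply: eq_bigr => i _; rewrite n1 (nrm_sqr sb)//; last first.
    by apply: linsubB => //; [exact: Vfh (VQ _ _ huH)|exact: Vfh (Huf i)].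
  by rewrite /eH /e (corrector_sub_ker VhW VfW Vfh sa sb sT halpha ab_ge VQ aQ).
have CI1 : 1 <= CI.
  have := IHn _ hv0; rewrite (IHid _ Hv0) n1 /nrm bv0 sqrtr1 mulr1.
  by [].
have IHe : IH (eH - \sum_i e i) = eH.
  have IHs : IH (\sum_i e i) = 0.
    suff [] : Vh (\sum_i e i) /\ IH (\sum_i e i) = 0 by [].
    apply: (big_ind (fun w => Vh w /\ IH w = 0)).
    - split=> //; apply: IHid; by case: VHW.
    - move=> x y [hx Ix] [hy Iy]; split; first exact: linsubD.
      by rewrite -[x]scale1r IHl// Ix Iy scaler0 addr0.
    - by move=> i _; have := He i; rewrite hVf => -[[? ?] _].
  rewrite addrC -scaleN1r IHl//; last exact: linsub_sum.
  by rewrite IHs scaler0 add0r IHid.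
have beH : b eH eH <= CI ^+ 2 * b (eH - \sum_i e i) (eH - \sum_i e i).
  have := IHn _ hd; rewrite IHe !n1 => H.
  rewrite -(nrm_sqr sb heH) -(nrm_sqr sb hd) -exprMn.
  by rewrite ler_pXn2r// nnegrE ?mulr_ge0 ?nrm_ge0// (le_trans _ CI1).
have CI0 : 0 <= CI by exact: le_trans CI1.
have E1_le := tse2_le VhW VfW VHh Vfh sa halpha hbeta ab_ge VQ C0 rhoE HeH He CI1 beH.
have C01 : Covl%:R = 0 :> R \/ 1 <= Covl%:R :> R.
  by case: (Covl) => [|c]; [left|right; rewrite ler1n].
have E2_le1 := tsa2_le VhW VfW VHh Vfh sa sb sT halpha hbeta ab_le aT_le VQ aQ C0 rhoE ovl HeH He C01.
have ea : eta_a_u = Num.sqrt 5 * gamma^-1 * r by [].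
have e1 : eta_1_u = Num.sqrt 5 * CI * (Num.sqrt alpha)^-1 * gamma^-1 * r by [].
rewrite -/E2 in E1_le E2_le1; clearbody eta_a_u eta_1_u err_a err_1 r E2.
have s5 : Num.sqrt 5 ^+ 2 = 5 :> R by rewrite sqr_sqrtr.
have sal : Num.sqrt alpha ^+ 2 = alpha by rewrite sqr_sqrtr// ltW.
have sal0 : 0 < Num.sqrt alpha by rewrite sqrtr_gt0.
have g0 : gamma != 0 by rewrite gt_eqF.
have al0 : alpha != 0 by rewrite gt_eqF.
have gi0 : 0 <= gamma^-1 by rewrite invr_ge0 ltW.
have sqrt_le (x y : R) : 0 <= y -> x <= y ^+ 2 -> Num.sqrt x <= y.
  by move=> y0 xy; rewrite -(ger0_norm y0) -sqrtr_sqr ler_wsqrtr.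
rewrite ea e1 err_aE err_1E; split.
- apply: sqrt_le; first by rewrite !mulr_ge0// sqrtr_ge0.
  by rewrite !exprMn s5 exprVn.
- by rewrite -[leRHS]mulrA ler_wpM2l// mulr_ge0// sqrtr_ge0.
- apply: sqrt_le; first by rewrite !mulr_ge0// ?invr_ge0 sqrtr_ge0.
  apply: le_trans E1_le _.
  apply: le_trans (ler_wpM2l _ E2_le) _; first by rewrite divr_ge0 ?sqr_ge0// ltW.
  rewrite !exprMn s5 !exprVn sal.
  rewrite le_eqVlt; apply/orP; left; apply/eqP; field; by rewrite g0 al0.
- have sE : Num.sqrt E2 <= Num.sqrt 3 * Num.sqrt (Covl%:R + 1) * Num.sqrt beta *
      Num.sqrt (tse2 b Q rho eH e).
    rewrite -!sqrtrM ?mulr_ge0 ?addr_ge0// ?(ltW beta0)//.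
    exact: ler_wsqrtr.
  have -> : Num.sqrt 15 = Num.sqrt 5 * Num.sqrt 3 :> R.
    by rewrite -sqrtrM//; congr Num.sqrt; ring.
  have -> : Num.sqrt kappa = Num.sqrt beta / Num.sqrt alpha.
    by rewrite hkappa sqrtrM ?(ltW beta0)// sqrtrV// ltW.
  set t := Num.sqrt 5 * CI * (Num.sqrt alpha)^-1 * gamma^-1.
  have t0 : 0 <= t by rewrite !mulr_ge0// ?invr_ge0 sqrtr_ge0.
  apply: le_trans (ler_wpM2l t0 (le_trans r_le (ler_wpM2l (sqrtr_ge0 _) sE))) _.
  rewrite le_eqVlt; apply/orP; left; apply/eqP; rewrite /t; field.
  by rewrite g0 gt_eqF.
Qed.
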